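(* Let $\mathcal B\subseteq\mathbb N$ be an infinite primitive set, with associated compact group $H$, diagonal embedding $\Delta:\mathbb Z\to H$, Haar measure $m_H$ and window $W\subseteq H$. Then the following are equivalent: (i) $\mathcal B$ is taut. (ii) The window $W$ is Haar regular, i.e. $\operatorname{supp}(m_H|_W)=W$. Moreover, these properties imply (iii) $\overline{\Delta(\mathbb Z)\cap W}=W$.
   Context: $\mathbb N=\{1,2,\dots\}$. For $A\subseteq\mathbb N$ let $\mathcal M_A=\bigcup_{a\in A}a\mathbb Z$. A set $\mathcal B\subseteq\mathbb N$ is primitive if there are no distinct $b,b'\in\mathcal B$ with $b\mid b'$. For a set $\mathcal M$ of integers the logarithmic density is $\boldsymbol\delta(\mathcal M)=\lim_{n\to\infty}\frac1{\log n}\sum_{1\le k\le n,\,k\in\mathcal M}\frac1k$ whenever the limit exists; by the Davenport–Erdős theorem it exists for every set of multiples $\mathcal M_A$. $\mathcal B$ is taut if $\boldsymbol\delta(\mathcal M_{\mathcal B\setminus\{b\}})<\boldsymbol\delta(\mathcal M_{\mathcal B})$ for each $b\in\mathcal B$. $\Delta:\mathbb Z\to\prod_{b\in\mathcal B}\mathbb Z/b\mathbb Z$ is $\Delta(n)=(n \bmod b)_{b\in\mathcal B}$; $H:=\overline{\Delta(\mathbb Z)}$ (closure in the product topology) is a compact abelian group with normalized Haar measure $m_H$; the window is $W:=\{h\in H: h_b\neq 0\ \text{for all } b\in\mathcal B\}$. $m_H|_W$ is the restriction of $m_H$ to $W$ (i.e. $A\mapsto m_H(A\cap W)$) and $\operatorname{supp}$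 denotes the topological support. *)

(* Defs.v *)
From HB Require Import structures.
From mathcomp Require Import all_boot all_order all_algebra.
From mathcomp Require Import all_classical all_reals all_analysis.

Set Implicit Arguments.
Unset Strict Implicit.
Unset Printing Implicit Defensive.

Import Order.TTheory GRing.Theory Num.Theory numFieldNormedType.Exports.

Local Open Scope classical_set_scope.
Local Open Scope ring_scope.

Definition multiples (A : set nat) : set int :=
  [set k | exists2 a, A a & (a%:Z %| k)%Z].

Definition primitive (B : set nat) : Prop :=
  forall b b', B b -> B b' -> (b %| b')%N -> b = b'.

(* [lim] is total: its value is unspecified when the limit does not exist; for
   sets of multiples it exists by the Davenport-Erdos theorem. *)
Definition log_density (R : realType) (M : set int) : R :=
  lim ((fun n : nat =>
    (ln n%:R)^-1 * \sum_(1 <= k < n.+1 | (k%:Z : int) \in M) (k%:R : R)^-1)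
    @ \oo).

Definition taut (R : realType) (B : set nat) : Prop :=
  forall b, B b ->
    log_density R (multiples (B `\ b)) < log_density R (multiples B).

(* For b > 0 this is 'I_b with addition modulo b; the shape b.-1.+1 also makes
   b = 1 the trivial group, unlike 'Z_1. Also trivial for b = 0, which never occurs here. *)
Definition Zmod (b : nat) : Type := discrete_topology 'I_b.-1.+1.

HB.instance Definition _ (b : nat) := GRing.Zmodule.copy (Zmod b) 'I_b.-1.+1.
HB.instance Definition _ (b : nat) :=
  DiscreteTopology.copy (Zmod b) (discrete_topology 'I_b.-1.+1).

Definition residue (b : nat) (n : int) : Zmod b :=
  (inZp `|(n %% b)%Z|%N : 'I_b.-1.+1).

Lemma val_residue (b : nat) (n : int) : (0 < b)%N ->
  (residue b n : 'I_b.-1.+1)%:Z = (n %% b)%Z.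
Proof.
move=> b0; rewrite /residue /= prednK// -modz_nat gez0_abs ?modz_ge0 ?modz_mod//.
by rewrite eqz_nat -lt0n.
Qed.

Lemma residueB (b : nat) (m n : int) :
  residue b (m - n) = residue b m - residue b n.
Proof.
case: (posnP b) => [->|b0]; first by apply/val_inj; rewrite /= !modn1.
apply/val_inj; apply/eqP; rewrite -eqz_nat; apply/eqP.
rewrite [LHS](val_residue (m - n) b0) /=.
have rE k : `|(k %% b)%Z|%N%:Z = (k %% b)%Z.
  by rewrite gez0_abs// modz_ge0// eqz_nat -lt0n.
have rb k : (`|(k %% b)%Z|%N < b)%N.
  by rewrite -ltz_nat rE ltz_pmod.
rewrite !prednK// !(modn_small (rb _)) modnDmr.
rewrite -modz_nat PoszD -subzn ?(ltnW (rb _))// !rE.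
by by rewrite addrCA modzDl modzDml -[LHS]modzDmr -modzNm modzDmr.
Qed.

Definition residues (B : set nat) : Type :=
  prod_topology (fun b : B => Zmod (val b)).

HB.instance Definition _ (B : set nat) := Topological.on (residues B).

Section residues_group.
Variable B : set nat.
Implicit Types x y z : residues B.

Definition residues0 : residues B := fun b => 0.
Definition residues_opp x : residues B := fun b => - x b.
Definition residues_add x y : residues B := fun b => x b + y b.

Lemma residues_addA : associative residues_add.
Proof. by move=> x y z; apply: functional_extensionality_dep => b; apply: addrA. Qed.
Lemma residues_addC : commutative residues_add.
Proof. by move=> x y; apply: functional_extensionality_dep => b; apply: addrC. Qed.
Lemma residues_add0 : left_id residues0 residues_add.
Proof. by move=> x; apply: functional_extensionality_dep => b; apply: add0r. Qed.
Lemma residues_addN : left_inverse residues0 residues_opp residues_add.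
Proof. by move=> x; apply: functional_extensionality_dep => b; apply: addNr. Qed.

HB.instance Definition _ := GRing.isZmodule.Build (residues B)
  residues_addA residues_addC residues_add0 residues_addN.

Lemma residues_sub_continuous :
  continuous (fun x : residues B * residues B => x.1 - x.2).
Proof.
move=> [x y].
apply/cvg_sup => b.
apply: (@continuous_comp_initial _ _ _
  (fun f : forall i : B, Zmod (val i) => f b)
  (fun p : residues B * residues B => p.1 - p.2)).
move=> {x y} [x y] /=.
apply/(discrete_cvg (X := Zmod (val b))).
have nb (z : residues B) : \forall t \near z, t b = z b.
  exact: (@proj_continuous _ (fun i : B => Zmod (val i)) b z _
    (discrete_set1 (X := Zmod (val b)) (z b))).
exists ([set t | t b = x b], [set t | t b = y b]); first by split; apply: nb.
by move=> [u v] /= [uE vE]; rewrite -[LHS]/(u b - v b) uE vE.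
Qed.

HB.instance Definition _ :=
  PreTopologicalNmodule_isTopologicalZmodule.Build (residues B)
    residues_sub_continuous.

End residues_group.

Definition diag_residues (B : set nat) (n : int) : residues B :=
  fun b => residue (val b) n.
Arguments diag_residues : clear implicits.

Definition Hset (B : set nat) : set (residues B) :=
  closure (range (diag_residues B)).

Arguments Hset : clear implicits.

Definition Hgroup (B : set nat) : Type := set_type (Hset B).

HB.instance Definition _ (B : set nat) := SubType.on (Hgroup B).
HB.instance Definition _ (B : set nat) := Topological.on (Hgroup B).

Section Hgroup_group.
Variable B : set nat.

Lemma diag_residuesB (m n : int) : diag_residues B (m - n) = diag_residues B m - diag_residues B n.
Proof. by apply: functional_extensionality_dep => b; apply: residueB. Qed.

Lemma diag_residues_Hset (n : int) : diag_residues B n \in Hset B.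
Proof. by apply/mem_set/subset_closure; exists n. Qed.

Lemma Hset_sub (x y : residues B) : Hset B x -> Hset B y -> Hset B (x - y).
Proof.
move=> Hx Hy U /(@sub_continuous (residues B) (x, y)) /= [[P Q] [/= Px Qy] PQU].
have [_ [[m _ <-] Pm]] := Hx _ Px; have [_ [[n _ <-] Qn]] := Hy _ Qy.
exists (diag_residues B (m - n)); split; first by exists (m - n).
by rewrite diag_residuesB; apply: (PQU (diag_residues B m, diag_residues B n)).
Qed.

Lemma Hset_zmod_closed : zmod_closed (fun x : residues B => x \in Hset B).
Proof.
split; last by move=> x y /set_mem Hx /set_mem Hy; apply/mem_set/Hset_sub.
by rewrite -(subrr (diag_residues B 0)) -diag_residuesB; apply: diag_residues_Hset.
Qed.

HB.instance Definition _ := GRing.SubChoice_isSubZmodule.Build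
  (residues B) (fun x => x \in Hset B) (Hgroup B) Hset_zmod_closed.

Lemma Hgroup_sub_continuous :
  continuous (fun p : Hgroup B * Hgroup B => p.1 - p.2).
Proof.
have vc (z : Hgroup B) : {for z, continuous (val : Hgroup B -> residues B)}.
  exact: (@initial_continuous (Hset B) (residues B) set_val).
apply: (@continuous_comp_initial _ _ _ (val : Hgroup B -> residues B)).
move=> [x y] U /= nU.
have [[P Q] [/= Px Qy] PQU] := @sub_continuous (residues B) (val x, val y) U nU.
exists (val @^-1` P, val @^-1` Q); first by split; apply: vc.
by move=> [u v] /= [Pu Qv]; apply: (PQU (val u, val v)).
Qed.

HB.instance Definition _ :=
  PreTopologicalNmodule_isTopologicalZmodule.Build (Hgroup B)
    Hgroup_sub_continuous.
HB.instance Definition _ := isPointed.Build (Hgroup B) 0.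

Definition Delta (n : int) : Hgroup B := SigSub (diag_residues_Hset n).

Definition window : set (Hgroup B) := [set h | forall b : B, val h b <> 0].

Lemma closed_window : closed window.
Proof.
have -> : window = \bigcap_(b in [set: B])
    ((fun h : Hgroup B => val h b) @^-1` [set v : Zmod (val b) | v <> 0]).
  by apply/seteqP; split=> h /= hW b; [move=> _|]; apply: hW.
apply: closed_bigI => b _; apply: preimage_closed => [h _|]; last first.
  exact: (discrete_closed (X := Zmod (val b))).
apply: (@continuous_comp _ _ _ (val : Hgroup B -> residues B)
  (fun f : residues B => f b)).
  exact: (@initial_continuous (Hset B) (residues B) set_val).
exact: (@proj_continuous _ (fun i : B => Zmod (val i)) b).
Qed.

End Hgroup_group.

Arguments Delta : clear implicits.
Arguments window : clear implicits.

Definition borel (T : ptopologicalType) := g_sigma_algebraType (@open T).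

Lemma measurable_window (B : set nat) :
  measurable (window B : set (borel (Hgroup B))).
Proof.
rewrite -[window B]setCK; apply: measurableC; apply: sub_sigma_algebra.
exact/closed_openC/closed_window.
Qed.
Arguments measurable_window : clear implicits.

(* H is compact and metrizable, so its normalized Haar measure is the unique
   translation-invariant Borel probability measure (regularity is automatic). *)
Definition is_haar (R : realType) (B : set nat)
    (m : probability (borel (Hgroup B)) R) : Prop :=
  forall (g : Hgroup B) (A : set (borel (Hgroup B))),
    measurable A -> m [set g + h | h in A] = m A.

Definition supp (R : realType) (T : topologicalType) (mu : set T -> \bar R) :
    set T :=
  [set x | forall U : set T, open U -> U x -> (0 < mu U)%E].

Definition haar_regular (R : realType) (B : set nat)
    (m : probability (borel (Hgroup B)) R) : Prop :=
  supp (T := Hgroup B) (mrestr m (measurable_window B)) = window B.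

(* Main.v *)
(* Call A a Behrend set if its multiples have density 1. Harris' correlation
   inequality on divisor lattices gives two things. First, Behrend's inequality:
   a finite union of non-Behrend sets is non-Behrend. Second, the sum of k^(-s)
   over the multiples of A is at most the density of the multiples times zeta(s),
   for every s > 1; taking s = 1 + 1 / ln n yields the Davenport-Erdos theorem.
   Hence, for primitive B, tautness means that {a : d a in B} is not Behrend
   whenever d is not in B.

   A cylinder of H around a point of W corresponds to a progression n + l Z such
   that no b in B divides both n and l. By Behrend's inequality, the B-free part of
   this progression has density at least 1/l times the product, over the divisors d
   of gcd(n, l), of the densities of the integers free of {a : d a in B}. If B is
   taut this is positive, so W has positive measure in the cylinder, and by
   Davenport-Erdos the progression contains a B-free integer. If B is not taut,
   some {a : d a in B} is Behrend with d a proper divisor of some b in B; then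
   Delta(d) lies in W, but the cylinder h_b = d mod b meets W in a null set. *)

Require Import Defs.
From mathcomp Require Import all_boot all_order all_algebra.
From mathcomp Require Import ring lra.
From mathcomp Require Import all_classical all_reals all_analysis.

Set Implicit Arguments.
Unset Strict Implicit.
Unset Printing Implicit Defensive.

Import Order.TTheory GRing.Theory Num.Theory numFieldNormedType.Exports.

Local Open Scope classical_set_scope.
Local Open Scope ring_scope.

(** * Harris' inequality on divisor lattices *)

Section Harris.
Variable R : realFieldType.

(** Chebyshev's sum inequality: the double sum of w x w y (f x - f y) (g x - g y) has nonnegative
    terms and expands to twice the difference of the two sides. *)
Lemma chebyshev_sum (s : seq nat) (w f g : nat -> R) :
  (forall x, 0 <= w x) ->
  {in s &, forall x y, 0 <= (f x - f y) * (g x - g y)} ->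
  (\sum_(x <- s) w x * f x) * (\sum_(x <- s) w x * g x) <=
  (\sum_(x <- s) w x) * (\sum_(x <- s) w x * (f x * g x)).
Proof.
move=> w0 fg.
have : 0 <= \sum_(x <- s) \sum_(y <- s) w x * w y * ((f x - f y) * (g x - g y)).
  rewrite big_seq; apply: sumr_ge0 => x xs; rewrite big_seq.
  by apply: sumr_ge0 => y ys; apply: mulr_ge0; [exact: mulr_ge0 | exact: fg].
have -> : \sum_(x <- s) \sum_(y <- s) w x * w y * ((f x - f y) * (g x - g y)) =
   2 * ((\sum_(x <- s) w x) * (\sum_(x <- s) w x * (f x * g x))
        - (\sum_(x <- s) w x * f x) * (\sum_(x <- s) w x * g x)).
  transitivity (\sum_(x <- s) \sum_(y <- s)
     (w x * (f x * g x) * w y + w x * (w y * (f y * g y))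
      - (w x * f x * (w y * g y)) - (w x * g x * (w y * f y)))).
    by apply: eq_bigr => x _; apply: eq_bigr => y _; ring.
  under eq_bigr => x _.
    rewrite !sumrB !big_split /= -!mulr_sumr.
    over.
  rewrite !sumrB !big_split /= -!mulr_suml.
  ring.
lra.
Qed.

(** Multiplication of pairs of divisors is inverted by d -> (gcd(d, a), gcd(d, b)). *)
Lemma big_divisors_coprime (a b : nat) (F : nat -> R) : (0 < a)%N -> (0 < b)%N ->
  coprime a b ->
  \sum_(d <- divisors (a * b)) F d =
  \sum_(x <- divisors a) \sum_(y <- divisors b) F (x * y)%N.
Proof.
move=> a0 b0 ab.
rewrite -(big_allpairs (F := fun p => F (p.1 * p.2)%N)).
rewrite -(big_map (fun p => p.1 * p.2)%N predT F) map_allpairs /=.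
apply: perm_big; apply: uniq_perm; first exact: divisors_uniq.
  apply: allpairs_uniq => [||[x y] [x' y']]; rewrite ?divisors_uniq //.
  move=> /allpairsP[[u v]/= []]; rewrite -!dvdn_divisors // => ua vb [-> ->].
  move=> /allpairsP[[u' v']/= []]; rewrite -!dvdn_divisors // => ua' vb' [-> ->].
  move=> /= e.
  have cop p q : (p %| a)%N -> (q %| b)%N -> coprime p q.
    by move=> pa qb; apply: (coprime_dvdl pa); apply: (coprime_dvdr qb).
  have uu : u = u'.
    apply/eqP; rewrite eqn_dvd -(Gauss_dvdl _ (cop _ _ ua vb')) -e dvdn_mulr //=.
    by rewrite -(Gauss_dvdl _ (cop _ _ ua' vb)) e dvdn_mulr.
  rewrite -uu in e *; congr (_, _); apply/eqP.
  by rewrite -(eqn_pmul2l (dvdn_gt0 a0 ua)) e.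
move=> d; rewrite -dvdn_divisors ?muln_gt0 ?a0 //.
apply/idP/allpairsP => [dab|[[u v] /= []]]; last first.
  by rewrite -!dvdn_divisors // => ua vb ->; apply: dvdn_mul.
exists (gcdn d a, gcdn d b); rewrite /= -!dvdn_divisors // !dvdn_gcdr; split=> //.
apply/eqP; rewrite eqn_dvd; apply/andP; split.
  rewrite muln_gcdl dvdn_gcd dvdn_mulr //= muln_gcdr dvdn_gcd dab andbT.
  by rewrite dvdn_mull.
rewrite Gauss_dvd ?dvdn_gcdl //.
by apply: (coprime_dvdl (dvdn_gcdr d a)); apply: (coprime_dvdr (dvdn_gcdr d b)).
Qed.

(** The first argument is the ambient number: the weight totient (N / x) behind Behrend's inequality
    depends on it, while k^(-s) does not. *)
Definition multiplicative_weight (w : nat -> nat -> R) :=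
  forall a b x y, (0 < a)%N -> (0 < b)%N -> coprime a b ->
    (x %| a)%N -> (y %| b)%N -> w (a * b)%N (x * y)%N = w a x * w b y.

(** Induction on N = a b, where a is the full power of one prime dividing N. The divisors of a form
    a chain, so Chebyshev's inequality handles the partial sums [F] and [G] over the divisors of b;
    for each fixed x, the induction hypothesis at b bounds F x G x. *)
Lemma harris_divisors (w : nat -> nat -> R) (f g : nat -> R) (N : nat) :
  (forall n x, 0 <= w n x) -> multiplicative_weight w -> (0 < N)%N ->
  {in divisors N &, forall x y, (x %| y)%N -> f x <= f y} ->
  {in divisors N &, forall x y, (x %| y)%N -> g x <= g y} ->
  (\sum_(d <- divisors N) w N d * f d) * (\sum_(d <- divisors N) w N d * g d) <=
  (\sum_(d <- divisors N) w N d) * (\sum_(d <- divisors N) w N d * (f d * g d)).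
Proof.
move=> w0 wM.
have [m] := ubnP N; elim: m N f g => // m IH N f g /ltnSE Nm N0 fm gm.
have [N1|N1] := leqP N 1.
  have -> : N = 1%N by apply/eqP; rewrite eqn_leq N1.
  by rewrite /divisors /= !big_seq1; rewrite le_eqVlt; apply/orP; left; apply/eqP; ring.
have pp := pdiv_prime N1; set p := pdiv N in pp.
have NE := partnC p N0; set a := (N`_p)%N in NE; set b := (N`_p^')%N in NE.
have a0 : (0 < a)%N by exact: part_gt0.
have b0 : (0 < b)%N by exact: part_gt0.
have ab : coprime a b by exact: (coprime_partC p N N).
have pa : (p %| a)%N.
  by rewrite /a p_part -[X in (X %| _)%N]expn1 dvdn_exp2l // -pfactor_dvdn // expn1 pdiv_dvd.
have a1 : (1 < a)%N by apply: (leq_trans (prime_gt1 pp)); apply: dvdn_leq.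
have bN : (b < N)%N by rewrite -NE -[X in (X < _)%N]mul1n ltn_pmul2r.
have mem x y : x \in divisors a -> y \in divisors b -> (x * y)%N \in divisors N.
  by rewrite -!dvdn_divisors // -NE => xa yb; apply: dvdn_mul.
pose F x := \sum_(y <- divisors b) w b y * f (x * y)%N.
pose G x := \sum_(y <- divisors b) w b y * g (x * y)%N.
pose W := \sum_(y <- divisors b) w b y.
have W0 : 0 <= W by apply: sumr_ge0 => y _; apply: w0.
have split_sum h : \sum_(d <- divisors N) w N d * h d =
   \sum_(x <- divisors a) w a x * \sum_(y <- divisors b) w b y * h (x * y)%N.
  rewrite -{1}NE big_divisors_coprime //; apply: eq_big_seq => x xa.
  rewrite mulr_sumr; apply: eq_big_seq => y yb.
  by rewrite -{1}NE wM ?mulrA // dvdn_divisors.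
have -> : \sum_(d <- divisors N) w N d = (\sum_(x <- divisors a) w a x) * W.
  have := split_sum (fun=> 1); under eq_bigr do rewrite mulr1.
  move=> ->; rewrite mulr_suml; apply: eq_bigr => x _.
  by congr (_ * _); apply: eq_bigr => y _; rewrite mulr1.
rewrite !split_sum -/(F _) -/(G _).
have Fm x x' : x \in divisors a -> x' \in divisors a -> (x %| x')%N -> F x <= F x'.
  move=> xa xa' xx'; rewrite /F !big_seq; apply: ler_sum => y yb.
  by rewrite ler_wpM2l // fm ?mem // dvdn_mul.
have Gm x x' : x \in divisors a -> x' \in divisors a -> (x %| x')%N -> G x <= G x'.
  move=> xa xa' xx'; rewrite /G !big_seq; apply: ler_sum => y yb.
  by rewrite ler_wpM2l // gm ?mem // dvdn_mul.
apply: (@le_trans _ _ ((\sum_(x <- divisors a) w a x) *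
    \sum_(x <- divisors a) w a x * (F x * G x))).
  apply: chebyshev_sum => // x y xa ya.
  have [xy|yx] : (x %| y)%N \/ (y %| x)%N.
    move: xa ya; rewrite -!dvdn_divisors // /a p_part.
    move=> /(dvdn_pfactor _ _ pp)[i _ ->] /(dvdn_pfactor _ _ pp)[j _ ->].
    by have [ij|/ltnW ij] := leqP i j; [left|right]; apply: dvdn_exp2l.
  - by rewrite mulr_le0 ?subr_le0 ?Fm ?Gm.
  - by rewrite mulr_ge0 ?subr_ge0 ?Fm ?Gm.
rewrite -mulrA ler_wpM2l ?sumr_ge0 // mulr_sumr !big_seq.
apply: ler_sum => x xa; rewrite [leRHS]mulrCA ler_wpM2l //.
apply: IH => // [|y y' yb yb' yy'|y y' yb yb' yy'].
- exact: leq_trans bN Nm.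
- by rewrite fm ?mem // dvdn_mul.
- by rewrite gm ?mem // dvdn_mul.
Qed.
End Harris.

(** * Densities of periodic sets *)

Section Counting.
Local Open Scope nat_scope.

Definition count_below (L : nat) (P : pred nat) : nat := \sum_(0 <= i < L) P i.

Lemma eq_count_below L P Q : P =1 Q -> count_below L P = count_below L Q.
Proof. by move=> PQ; apply: eq_bigr => i _; rewrite PQ. Qed.

Lemma count_below_le L P : count_below L P <= L.
Proof.
rewrite -[leqRHS](subn0 L) -[leqRHS]muln1 -sum_nat_const_nat.
by apply: leq_sum => i _; apply: leq_b1.
Qed.

Lemma periodic_mul L k (P : pred nat) :
  (forall i, P (i + L) = P i) -> forall i, P (i + k * L) = P i.
Proof.
move=> PL; elim: k => [|k IH] i; first by rewrite addn0.
by rewrite mulSn [(L + _)%N]addnC addnA PL.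
Qed.

Lemma periodic_mod L (P : pred nat) :
  (forall i, P (i + L) = P i) -> forall i, P (i %% L) = P i.
Proof.
move=> PL i; rewrite {2}(divn_eq i L) addnC; apply/esym.
exact: periodic_mul.
Qed.

Lemma count_belowM L k P : (forall i, P (i + L) = P i) ->
  count_below (k * L) P = k * count_below L P.
Proof.
move=> PL; elim: k => [|k IH]; first by rewrite /count_below big_geq.
rewrite !mulSn -IH addnC /count_below (big_cat_nat (n := k * L)) ?leq_addr //=.
rewrite addnC; congr (_ + _); rewrite -{1}[k * L]add0n big_addn addKn.
by apply: eq_bigr => i _; rewrite periodic_mul.
Qed.

Lemma count_below_scale g L P : 0 < g ->
  count_below (g * L) (fun i => (g %| i) && P (i %/ g)) = count_below L P.
Proof.
move=> g0; rewrite /count_below; elim: L => [|L IH]; first by rewrite muln0 !big_geq.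
rewrite big_nat_recr //= -IH mulnS addnC (big_cat_nat (n := g * L)) ?leq_addr //=.
congr (_ + _); rewrite big_ltn; last by rewrite -[X in X < _]addn0 ltn_add2l.
rewrite dvdn_mulr // mulKn //= big_nat_cond big1 ?addn0 // => i.
rewrite andbT => /andP[gi ig].
suff -> : (g %| i) = false by [].
apply/negP => /dvdnP[q iE]; move: gi ig.
rewrite iE [(q * g)%N]mulnC addnC -mulnS !ltn_pmul2l // ltnS => Lq.
by rewrite leqNgt Lq.
Qed.

Lemma count_below_chinese l L P n : 0 < l -> 0 < L -> coprime l L ->
  (forall i, P (i + L) = P i) ->
  count_below (l * L) (fun i => (i == n %[mod l]) && P i) = count_below L P.
Proof.
move=> l0 L0 cop PL; rewrite /count_below !big_mkord.
pose h (i : 'I_(l * L)) : 'I_l * 'I_L :=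
  (Ordinal (ltn_pmod i l0), Ordinal (ltn_pmod i L0)).
have h_inj : injective h.
  move=> i j [] ijl ijL; apply/val_inj => /=.
  rewrite -(modn_small (ltn_ord i)) -(modn_small (ltn_ord j)).
  by apply/eqP; rewrite chinese_remainder // ijl ijL !eqxx.
have h_bij : bijective h.
  by apply: inj_card_bij => //; rewrite card_prod !card_ord.
transitivity (\sum_(i < l * L) (((h i).1 == n %% l :> nat) && P (h i).2)).
  by apply: eq_bigr => i _; rewrite /= (periodic_mod PL).
rewrite -(reindex h (P := predT) (F := fun p => ((p.1 == n %% l :> nat) && P p.2 : nat))).
  rewrite -(pair_bigA _ (fun (a : 'I_l) (b : 'I_L) => ((a == n %% l :> nat) && P b : nat))) /=.
  rewrite (bigD1 (Ordinal (ltn_pmod n l0))) //=.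
  rewrite [X in _ + X]big1 ?addn0 => [|a an].
    by apply: eq_bigr => i _; rewrite eqxx.
  rewrite big1 // => b _.
  suff /negbTE -> : a != n %% l :> nat by [].
  by apply: contra an => /eqP an; apply/eqP/val_inj.
exact: onW_bij.
Qed.

(** The integers counted are the g j with j prime to N / g. *)
Lemma count_gcd N g : 0 < N -> g %| N ->
  count_below N (fun i => gcdn i N == g) = totient (N %/ g).
Proof.
move=> N0 gN; have g0 := dvdn_gt0 N0 gN.
have NE : N = g * (N %/ g) by rewrite mulnC divnK.
rewrite {1}NE totient_count_coprime.
rewrite -[RHS](count_below_scale (N %/ g) (fun i => coprime (N %/ g) i) g0).
apply: eq_count_below => i.
apply/eqP/andP => [<-|[/dvdnP[q ->]]].
  rewrite dvdn_gcdl; split => //; rewrite /coprime gcdnC.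
  have gi0 : 0 < gcdn i N by rewrite gcdn_gt0 N0 orbT.
  rewrite -(eqn_pmul2r gi0) muln_gcdl mul1n.
  by rewrite !divnK ?dvdn_gcdl ?dvdn_gcdr.
rewrite mulnK // => cop; rewrite {1}NE [g * _]mulnC -muln_gcdl gcdnC.
by rewrite (eqP cop) mul1n.
Qed.

(** Being prime to a b implies being prime to b, a condition of period b. *)
Lemma totient_mul_le a b : 0 < a -> 0 < b -> totient (a * b) <= a * totient b.
Proof.
move=> a0 b0; rewrite !totient_count_coprime.
have -> : \sum_(0 <= d < b) coprime b d = count_below b (coprime b) by [].
rewrite -count_belowM; last by move=> i; rewrite /coprime gcdnDr.
apply: leq_sum => i _; case: (boolP (coprime (a * b) i)) => //.
by rewrite coprimeMl => /andP[_ ->].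
Qed.

(** Carries an average over residues modulo N to the divisor lattice of N, where Harris' inequality
    applies. *)
Lemma sum_gcd (R : realFieldType) N (F : nat -> R) : 0 < N ->
  (\sum_(0 <= i < N) F (gcdn i N) =
   \sum_(g <- divisors N) (totient (N %/ g))%:R * F g)%R.
Proof.
move=> N0.
transitivity (\sum_(0 <= i < N) \sum_(g <- divisors N)
    (gcdn i N == g)%:R * F g)%R.
  apply: eq_bigr => i _.
  rewrite (bigD1_seq (gcdn i N)) ?divisors_uniq //=; last first.
    by rewrite -dvdn_divisors // dvdn_gcdr.
  rewrite eqxx mul1r big1 ?addr0 // => g /negbTE.
  by rewrite eq_sym => ->; rewrite mul0r.
rewrite exchange_big; apply: eq_big_seq => g; rewrite -dvdn_divisors // => gN.
by rewrite -count_gcd // /count_below natr_sum mulr_suml.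
Qed.

End Counting.

(** * Sieving by a finite list *)

Definition avoids (T : seq nat) (i : nat) : bool := all (fun t => ~~ (t %| i)%N) T.

Definition all_positive (T : seq nat) : bool := all (leq 1) T.

Definition quotients (d : nat) (T : seq nat) : seq nat :=
  [seq (t %/ d)%N | t <- T & (d %| t)%N].

Section Avoids.
Local Open Scope nat_scope.

Lemma avoids_periodic T L : {in T, forall t, t %| L} ->
  forall i, avoids T (i + L) = avoids T i.
Proof. by move=> TL i; apply: eq_in_all => t tT; rewrite dvdn_addl ?TL. Qed.

Lemma avoids_gcd T L i : {in T, forall t, t %| L} -> avoids T (gcdn i L) = avoids T i.
Proof. by move=> TL; apply: eq_in_all => t tT; rewrite dvdn_gcd TL ?andbT. Qed.

Lemma avoids_dvd T x y : x %| y -> avoids T y -> avoids T x.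
Proof.
move=> xy /allP yT; apply/allP => t /yT; apply: contra => tx.
exact: dvdn_trans xy.
Qed.

Lemma avoids_sub T T' i : {subset T <= T'} -> avoids T' i -> avoids T i.
Proof. by move=> TT' /allP T'i; apply/allP => t /TT'/T'i. Qed.

Lemma avoids_map_mul d T i : 0 < d -> d %| i ->
  avoids [seq d * t | t <- T] i = avoids T (i %/ d).
Proof.
move=> d0 /dvdnP[q ->]; rewrite mulnK // /avoids all_map.
by apply: eq_all => t /=; rewrite [q * d]mulnC dvdn_pmul2l.
Qed.

Lemma positive_prod T : all_positive T -> 0 < \prod_(t <- T) t.
Proof. by elim: T => [|t T IH] /=; rewrite ?big_nil // big_cons muln_gt0 => /andP[-> /IH]. Qed.

Lemma dvdn_prod_seq T : {in T, forall t, t %| \prod_(t <- T) t}.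
Proof.
elim: T => [|s T IH] t //; rewrite inE big_cons => /orP[/eqP ->|/IH tT].
  exact: dvdn_mulr.
exact: dvdn_mull.
Qed.

Lemma positive_cat T T' : all_positive (T ++ T') = all_positive T && all_positive T'.
Proof. exact: all_cat. Qed.

Lemma positive_sub T T' : {subset T <= T'} -> all_positive T' -> all_positive T.
Proof. by move=> TT' /allP p; apply/allP => t /TT'/p. Qed.

Lemma quotientsP d T a : 0 < d -> reflect (d * a \in T) (a \in quotients d T).
Proof.
move=> d0; apply: (iffP mapP) => [[t]|daT].
  by rewrite mem_filter => /andP[dt tT] ->; rewrite mulnC divnK.
by exists (d * a); rewrite ?mulKn // mem_filter dvdn_mulr.
Qed.

Lemma positive_quotients d T : 0 < d -> all_positive T -> all_positive (quotients d T).
Proof.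
move=> d0 /allP p; apply/allP => a /quotientsP -/(_ d0) /p.
by rewrite muln_gt0 => /andP[].
Qed.

End Avoids.

(** * Sieve densities and Behrend's inequality *)

Section Density.
Variable R : realFieldType.

(** For a predicate of period [L] this is its natural density, whichever positive period is
    taken. *)
Definition freq (L : nat) (P : pred nat) : R := (count_below L P)%:R / L%:R.

Lemma eq_freq L P Q : P =1 Q -> freq L P = freq L Q.
Proof. by move=> PQ; rewrite /freq (eq_count_below L PQ). Qed.

Lemma le_freq L (P Q : pred nat) : (forall i, P i -> Q i) -> freq L P <= freq L Q.
Proof.
move=> PQ; rewrite ler_wpM2r ?invr_ge0 // ler_nat; apply: leq_sum => i _.
by have := PQ i; case: (P i) => // ->.
Qed.

Lemma freq_ge0 L P : 0 <= freq L P.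
Proof. by rewrite divr_ge0. Qed.

Lemma freq_le1 L P : freq L P <= 1.
Proof.
have [->|L0] := posnP L; first by rewrite /freq invr0 mulr0.
by rewrite ler_pdivrMr ?ltr0n // mul1r ler_nat count_below_le.
Qed.

Lemma freqN L P : (0 < L)%N -> freq L (predC P) = 1 - freq L P.
Proof.
move=> L0; apply/eqP; rewrite eq_sym subr_eq /freq -mulrDl -natrD.
rewrite /count_below -big_split /=.
rewrite (eq_bigr (fun=> 1%N)) => [|i _]; last by case: (P i).
by rewrite sum_nat_const_nat subn0 muln1 divff // pnatr_eq0 -lt0n.
Qed.

Lemma freq_le_split L (P Q S : pred nat) : (forall i, P i -> Q i || S i) ->
  freq L P <= freq L Q + freq L S.
Proof.
move=> PQS; rewrite /freq -mulrDl ler_wpM2r ?invr_ge0 // -natrD ler_nat.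
rewrite /count_below -big_split /=; apply: leq_sum => i _.
by have := PQS i; case: (P i) => // /(_ isT); case: (Q i); case: (S i).
Qed.

Lemma freqM L k P : (0 < k)%N -> (forall i, P (i + L)%N = P i) ->
  freq (k * L) P = freq L P.
Proof.
move=> k0 PL; rewrite /freq count_belowM // !natrM.
by rewrite -mulf_div divff ?mul1r // pnatr_eq0 -lt0n.
Qed.

Lemma freq_period L L' P : (0 < L)%N -> (0 < L')%N ->
  (forall i, P (i + L)%N = P i) -> (forall i, P (i + L')%N = P i) ->
  freq L P = freq L' P.
Proof. by move=> L0 L0' PL PL'; rewrite -(freqM L0' PL) mulnC freqM. Qed.

Lemma freq_scale g L P : (0 < g)%N ->
  freq (g * L) (fun i => (g %| i)%N && P (i %/ g)%N) = freq L P / g%:R.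
Proof. by move=> g0; rewrite /freq count_below_scale // natrM invfM mulrA mulrAC. Qed.

Lemma freq_chinese l L P n : (0 < l)%N -> (0 < L)%N -> coprime l L ->
  (forall i, P (i + L)%N = P i) ->
  freq (l * L) (fun i => (i == n %[mod l]) && P i) = freq L P / l%:R.
Proof.
by move=> l0 L0 c PL; rewrite /freq count_below_chinese // natrM invfM mulrA mulrAC.
Qed.

(** The product serves only as a common multiple; [free_densityE] replaces it by any other positive
    one. *)
Definition free_density (T : seq nat) : R := freq (\prod_(t <- T) t)%N (avoids T).

Lemma free_densityE T L : (0 < L)%N -> {in T, forall t, (t %| L)%N} ->
  freq L (avoids T) = free_density T.
Proof.
move=> L0 TL; apply: freq_period => //.
- apply: positive_prod; apply/allP => t /TL; exact: dvdn_gt0.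
- exact: avoids_periodic.
- exact/avoids_periodic/dvdn_prod_seq.
Qed.

Lemma free_density_ge0 T : 0 <= free_density T.
Proof. exact: freq_ge0. Qed.

Lemma free_density_le1 T : free_density T <= 1.
Proof. exact: freq_le1. Qed.

Lemma free_density_nil : free_density [::] = 1.
Proof. by rewrite /free_density /freq big_nil /count_below big_nat1 divr1. Qed.

Lemma free_density1 a : (0 < a)%N -> free_density [:: a] = 1 - a%:R^-1.
Proof.
move=> a0; rewrite /free_density big_seq1.
rewrite (eq_freq _ (Q := predC (dvdn a))) => [|i]; last by rewrite /avoids /= andbT.
rewrite freqN //; congr (1 - _).
rewrite -{1}[a]muln1 (eq_freq _ (Q := fun i => (a %| i)%N && predT (i %/ a)%N)).
  by rewrite freq_scale // /freq /count_below big_nat1 divr1 mul1r.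
by move=> i; rewrite andbT.
Qed.

Lemma free_density_sub T T' : all_positive T' -> {subset T <= T'} ->
  free_density T' <= free_density T.
Proof.
move=> p TT'; pose L := (\prod_(t <- T') t)%N.
rewrite -(free_densityE (L := L)) ?positive_prod //; last exact: dvdn_prod_seq.
rewrite -[leRHS](free_densityE (L := L)) ?positive_prod // => [|t tT].
  by apply: le_freq => i; apply: avoids_sub.
by apply: dvdn_prod_seq; apply: TT'.
Qed.

(** Whether i is free of T depends only on gcd(i, L), so the count over residues becomes a weighted
    sum over divisors. *)
Lemma free_densityE_totient T L : (0 < L)%N -> {in T, forall t, (t %| L)%N} ->
  L%:R * free_density T =
  \sum_(g <- divisors L) (totient (L %/ g))%:R * (avoids T g)%:R.
Proof.
move=> L0 TL; rewrite -(free_densityE L0 TL) mulrC divfK ?pnatr_eq0 -?lt0n //.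
rewrite -(sum_gcd (fun g => (avoids T g)%:R)) // natr_sum.
by apply: eq_bigr => i _; rewrite avoids_gcd.
Qed.

Lemma sum_totient_divisors L : (0 < L)%N ->
  \sum_(g <- divisors L) (totient (L %/ g))%:R = L%:R :> R.
Proof.
move=> L0; have := sum_gcd (fun=> 1 : R) L0.
rewrite sumr_const_nat subn0 => ->.
by apply: eq_bigr => i _; rewrite mulr1.
Qed.

Lemma totient_weight_multiplicative :
  multiplicative_weight (fun N g => (totient (N %/ g))%:R : R).
Proof.
move=> a b x y a0 b0 ab xa yb; rewrite -natrM -totient_coprime.
  congr (totient _)%:R.
  have x0 := dvdn_gt0 a0 xa; have y0 := dvdn_gt0 b0 yb.
  have xy0 : (0 < x * y)%N by rewrite muln_gt0 x0.
  by apply/eqP; rewrite -(eqn_pmul2r xy0) divnK ?dvdn_mul // mulnACA !divnK.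
apply: (coprime_dvdl (dvdn_div xa)).
by apply: (coprime_dvdr (dvdn_div yb)).
Qed.

(* Behrend's inequality. *)
Lemma free_density_cat T T' : all_positive (T ++ T') ->
  free_density T * free_density T' <= free_density (T ++ T').
Proof.
move=> p; pose L := (\prod_(t <- T ++ T') t)%N.
have L0 : (0 < L)%N by exact: positive_prod.
have LR : 0 < L%:R :> R by rewrite ltr0n.
have LT : {in T ++ T', forall t, (t %| L)%N} by exact: dvdn_prod_seq.
(* Being T-free is decreasing for divisibility; the negated indicators are increasing, as Harris'
   inequality requires, and the two signs cancel in the products. *)
have av S : {in divisors L &, forall x y, (x %| y)%N ->
    - (avoids S x)%:R <= - (avoids S y)%:R :> R}.
  move=> x y _ _ /(avoids_dvd (T := S)); rewrite lerN2 ler_nat.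
  by case: (avoids S y) => // ->.
have := harris_divisors _ totient_weight_multiplicative L0 (av T) (av T').
move=> /(_ (fun _ _ => ler0n _ _)).
under eq_bigr do rewrite mulrN.
under [X in _ * X <= _]eq_bigr do rewrite mulrN.
rewrite !sumrN mulrNN sum_totient_divisors //.
under [X in _ <= _ * X]eq_bigr do rewrite mulrNN -natrM mulnb -all_cat.
rewrite -!free_densityE_totient // => [|t tT|t tT]; last 2 first.
- by apply: LT; rewrite mem_cat tT orbT.
- by apply: LT; rewrite mem_cat tT.
by rewrite mulrACA [leRHS]mulrA ler_pM2l ?mulr_gt0.
Qed.

Lemma free_density_flatten (s : seq (seq nat)) : all all_positive s ->
  \prod_(T <- s) free_density T <= free_density (flatten s).
Proof.
elim: s => [|T s IH] /=; first by rewrite big_nil free_density_nil.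
move=> /andP[pT ps]; rewrite big_cons.
apply: le_trans (free_density_cat _).
  by rewrite ler_wpM2l ?free_density_ge0 ?IH.
rewrite positive_cat pT; elim: s ps {IH} => //= S s IH /andP[pS /IH].
by rewrite positive_cat pS.
Qed.

(** Substituting i = d j turns the condition into T-freeness of j. *)
Lemma free_density_map_mul d T L : (0 < d)%N -> (0 < L)%N -> all_positive T ->
  {in T, forall t, (d * t %| L)%N} -> (d %| L)%N ->
  freq L (fun i => (d %| i)%N && avoids [seq (d * t)%N | t <- T] i) =
  free_density T / d%:R.
Proof.
move=> d0 L0 pT TL dL; pose K := (\prod_(t <- T) t)%N.
pose P i := (d %| i)%N && avoids T (i %/ d)%N.
rewrite (eq_freq _ (Q := P)) => [|i]; last first.
  by rewrite /P; case: (boolP (d %| i)%N) => //= di; rewrite avoids_map_mul.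
rewrite -freq_scale //; apply: freq_period => //.
- by rewrite muln_gt0 d0 positive_prod.
- move=> i; rewrite /P dvdn_addl //; case: (boolP (d %| i)%N) => //= di.
  rewrite divnDr // avoids_periodic // => t tT.
  by rewrite dvdn_divRL // mulnC TL.
- move=> i; rewrite /P dvdn_addl ?dvdn_mulr //; case: (boolP (d %| i)%N) => //= di.
  by rewrite divnDr ?dvdn_mulr // mulKn // avoids_periodic //; apply: dvdn_prod_seq.
Qed.

(* Writing g = gcd(n, l) and i = g j, the residue of j modulo l / g is invertible,
   so j can only be divisible by those t / gcd(t, g) that are coprime to l / g. *)
Lemma progression_free_density n l L T : (0 < l)%N -> (0 < L)%N -> all_positive T ->
  (l %| L)%N -> {in T, forall t, (t %| L)%N} ->
  (\prod_(d <- divisors (gcdn n l)) free_density (quotients d T)) / l%:R <=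
  freq L (fun i => (i == n %[mod l]) && avoids T i).
Proof.
move=> l0 L0 pT lL TL; have [g gE] : {g | gcdn n l = g} by exists (gcdn n l).
rewrite gE.
have g0 : (0 < g)%N by rewrite -gE gcdn_gt0 l0 orbT.
have [gn gl] : (g %| n)%N /\ (g %| l)%N by rewrite -gE dvdn_gcdl dvdn_gcdr.
pose n' := (n %/ g)%N; pose l' := (l %/ g)%N.
have nE : (n = g * n')%N by rewrite mulnC divnK.
have lE : (l = g * l')%N by rewrite mulnC divnK.
have l'0 : (0 < l')%N by rewrite divn_gt0 // dvdn_leq.
have n'l' : coprime n' l'.
  by rewrite /coprime -(eqn_pmul2l g0) muln_gcdr -nE -lE muln1 gE.
pose A := [seq s <- [seq (t %/ gcdn t g)%N | t <- T] | coprime s l'].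
have pA : all_positive A.
  apply/allP => s; rewrite mem_filter => /andP[_ /mapP[t tT ->]].
  have t0 := allP pT _ tT.
  by rewrite divn_gt0 ?gcdn_gt0 ?t0 // dvdn_leq ?dvdn_gcdl.
pose K := (\prod_(s <- A) s)%N.
have K0 : (0 < K)%N by exact: positive_prod.
have l'K : coprime l' K.
  rewrite /K coprime_sym; have : {in A, forall s, coprime s l'}.
    by move=> s; rewrite mem_filter => /andP[].
  elim: A {pA K K0} => [|s A IH] cA; first by rewrite big_nil coprime1n.
  rewrite big_cons coprimeMl cA ?mem_head ?IH // => t tA.
  by apply: cA; rewrite inE tA orbT.
pose Q j := (j == n' %[mod l']) && avoids A j.
have PQ i : (i == n %[mod l]) && avoids T i = (g %| i)%N && Q (i %/ g)%N.
  have [/dvdnP[j ->]|gi] := boolP (g %| i)%N; last first.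
    suff /negbTE -> : i != n %[mod l] by [].
    apply: contra gi => /eqP /(congr1 (modn^~ g)).
    by rewrite !modn_dvdm // => e; rewrite /dvdn e -/(dvdn g n).
  rewrite /= mulnK // /Q {1}nE {1 2}lE [(j * g)%N]mulnC -!muln_modr eqn_pmul2l //.
  case: (boolP (j == n' %[mod l'])) => //= /eqP jn'.
  have jl' : coprime j l' by rewrite -coprime_modl jn' coprime_modl.
  apply/allP/allP => H.
    move=> s; rewrite mem_filter => /andP[_ /mapP[t tT ->]].
    apply: contra (H _ tT) => /dvdnP[q ->].
    have /dvdnP[r rE] := dvdn_gcdr t g.
    rewrite [X in (_ %| X * _)%N]rE -mulnA dvdn_mull // mulnCA dvdn_mull //.
    by rewrite mulnC divnK // dvdn_gcdl.
  (* If t divides g j, then t / gcd(t, g) divides j; as j is prime to l', so is this quotient, which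
     therefore belongs to [A]. *)
  move=> t tT; apply/negP => tgj.
  have dg : (0 < gcdn t g)%N by rewrite gcdn_gt0 g0 orbT.
  have tj : (t %/ gcdn t g %| j)%N.
    rewrite -(@Gauss_dvdr _ (g %/ gcdn t g)).
      rewrite -(dvdn_pmul2r dg) divnK ?dvdn_gcdl // mulnAC divnK ?dvdn_gcdr //.
    rewrite /coprime -(eqn_pmul2r dg) muln_gcdl !divnK ?dvdn_gcdl ?dvdn_gcdr //.
    by rewrite mul1n.
  suff sA : (t %/ gcdn t g)%N \in A by have := H _ sA; rewrite tj.
  rewrite mem_filter (coprime_dvdl tj jl') /=.
  exact: (map_f (fun t => t %/ gcdn t g)%N).
have QK i : Q (i + l' * K)%N = Q i.
  rewrite /Q -modnDmr modnMr addn0 avoids_periodic // => s sA.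
  by rewrite dvdn_mull // dvdn_prod_seq.
have -> : freq L (fun i => (i == n %[mod l]) && avoids T i) =
    free_density A / l%:R.
  rewrite (@freq_period _ (g * (l' * K))) //; first last.
  - move=> i; rewrite !PQ dvdn_addl ?dvdn_mulr //.
    case: (boolP (g %| i)%N) => //= gi.
    by rewrite divnDr ?dvdn_mulr // mulKn // QK.
  - move=> i; rewrite avoids_periodic //; congr (_ && _).
    by case/dvdnP: lL => q ->; rewrite addnC modnMDl.
  - by rewrite !muln_gt0 g0 l'0.
  rewrite (eq_freq _ PQ) freq_scale // freq_chinese //; last first.
    exact/avoids_periodic/dvdn_prod_seq.
  rewrite -[freq K _]/(free_density A) -mulrA -invfM -natrM.
  by rewrite [(l' * g)%N]mulnC -lE.
rewrite ler_wpM2r ?invr_ge0 //.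
(* Each element of [A] is t / d with d = gcd(t, g), a divisor of g, hence lies in [quotients d T].
   Enlarging [A] to the union over d only lowers the density, and Behrend's inequality bounds the
   union below by the product. *)
rewrite -(big_map (fun d => quotients d T) predT free_density).
apply: le_trans (free_density_flatten _) _.
  apply/allP => S /mapP[d]; rewrite -dvdn_divisors // => dg ->.
  exact/positive_quotients/pT/dvdn_gt0/dg.
apply: free_density_sub.
  apply/allP => a /flattenP[S /mapP[d]]; rewrite -dvdn_divisors // => dg ->.
  exact/allP/positive_quotients/pT/dvdn_gt0/dg.
move=> s; rewrite mem_filter => /andP[_ /mapP[t tT sE]].
apply/flattenP; exists (quotients (gcdn t g) T).
  by apply: map_f; rewrite -dvdn_divisors // dvdn_gcdr.
apply/mapP; exists t => //; by rewrite mem_filter dvdn_gcdl.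
Qed.

End Density.

(** * The Davenport-Erdos theorem *)

Section LogSums.
Variable R : realType.
Implicit Types (u : nat -> R) (P Q : pred nat).

(** Summation by parts. Monotonicity of [u] is required from index 1 on only: the reciprocal of 0 is
    0, so 1/k is not nonincreasing from 0. *)
Lemma abel_bound (a u : nat -> R) (C : R) (n : nat) :
  (forall k, 0 <= u k) -> (forall k, u k.+2 <= u k.+1) -> 0 <= C ->
  (forall m, \sum_(1 <= k < m.+1) a k <= C) ->
  \sum_(1 <= k < n.+1) a k * u k <= C * u 1%N.
Proof.
move=> u0 u_noninc C0 aC; case: n => [|n].
  by rewrite big_geq // mulr_ge0.
(* The added term is nonpositive; keeping it makes the induction go through, since it grows when the
   weight decreases. *)
suff H : \sum_(1 <= k < n.+2) a k * u k <=
    C * u 1%N + (\sum_(1 <= k < n.+2) a k - C) * u n.+1.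
  apply: (le_trans H); rewrite gerDl mulr_le0_ge0 //.
  by rewrite subr_le0 aC.
elim: n => [|n IH]; first by rewrite !big_nat1; lra.
rewrite big_nat_recr //= [X in (X - C)]big_nat_recr //=.
have h1 := aC n.+1; have h2 := u_noninc n.
move: IH h1; set s := \sum_(1 <= k < n.+2) a k; move=> IH h1.
have : (s - C) * u n.+1 <= (s - C) * u n.+2.
  by rewrite ler_wnM2l // subr_le0.
lra.
Qed.

(** Summation by parts with coefficients P k - f, f being the frequency of P. Covering [0, m] by one
    more than (m + 1) / L periods bounds their partial sums by f + f L <= L + 1. *)
Lemma sum_periodic_le u P L n :
  (0 < L)%N -> (forall i, P (i + L)%N = P i) ->
  (forall k, 0 <= u k) -> (forall k, u k.+2 <= u k.+1) ->
  \sum_(1 <= k < n.+1 | P k) u k <=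
  L.+1%:R * u 1%N + freq R L P * \sum_(1 <= k < n.+1) u k.
Proof.
move=> L0 PL u0 u_noninc; set f := freq R L P.
suff : \sum_(1 <= k < n.+1) ((P k)%:R - f) * u k <= L.+1%:R * u 1%N.
  rewrite -lerBlDr [X in X <= _ -> _](_ : _ =
    \sum_(1 <= k < n.+1 | P k) u k - f * \sum_(1 <= k < n.+1) u k) //.
  under eq_bigr do rewrite mulrBl.
  rewrite sumrB -mulr_sumr [in RHS]big_mkcond; congr (_ - _).
  by apply: eq_bigr => k _; case: (P k); rewrite ?mul1r ?mul0r.
apply: abel_bound => // m.
have f0 : 0 <= f by exact: freq_ge0.
have f1 : f <= 1 by exact: freq_le1.
rewrite sumrB sumr_const_nat subn1 /= -natr_sum.
have LR : 0 < L%:R :> R by rewrite ltr0n.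
have cnt : (\sum_(1 <= k < m.+1) P k <= (m.+1 %/ L).+1 * count_below L P)%N.
  rewrite -count_belowM // /count_below.
  rewrite (leq_trans (n := \sum_(0 <= k < m.+1) P k)) //.
    by rewrite [leqRHS]big_ltn // leq_addl.
  rewrite [leqRHS](big_cat_nat (n := m.+1)) ?leq_addr //=.
  by apply: ltnW; rewrite -ltn_divLR.
have qm : (m.+1 %/ L * L <= m.+1)%N by exact: leq_divM.
have cE : (count_below L P)%:R = f * L%:R by rewrite /f /freq divfK ?gt_eqF.
move: cnt; rewrite -(ler_nat R) natrM cE => cnt.
move: qm; rewrite -(ler_nat R) natrM => qm.
rewrite -[f *+ m]mulr_natr.
move: cnt qm; rewrite -!natr1 => cnt qm.
set q := (_ %/ _)%:R in cnt qm.
have : f * (q * L%:R) <= f * (m%:R + 1) by rewrite ler_wpM2l.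
have : f * L%:R <= L%:R by rewrite ler_piMl.
lra.
Qed.

Lemma ln_succ_le (x : R) : 0 < x -> ln (x + 1) - ln x <= x^-1.
Proof.
move=> x0; rewrite -ln_div ?posrE ?addr_gt0 // mulrDl divff ?gt_eqF // mul1r.
by apply: le_ln1Dx; rewrite (lt_trans _ (_ : 0 < _)) ?invr_gt0 //; lra.
Qed.

Lemma ln_succ_ge (x : R) : 0 < x -> (x + 1)^-1 <= ln (x + 1) - ln x.
Proof.
move=> x0; have x1 : 0 < x + 1 by lra.
rewrite -opprB -ln_div ?posrE // lerNr.
have -> : x / (x + 1) = 1 + - (x + 1)^-1.
  by field; rewrite gt_eqF.
apply: le_ln1Dx.
by rewrite ltrN2 invf_lt1 //; lra.
Qed.

Definition harmonic_sum (P : pred nat) (n : nat) : R :=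
  \sum_(1 <= k < n.+1 | P k) k%:R^-1.

Lemma harmonic_sumS n :
  harmonic_sum xpredT n.+1 = harmonic_sum xpredT n + n.+1%:R^-1.
Proof. by rewrite /harmonic_sum big_nat_recr. Qed.

Lemma harmonic_sum1 : harmonic_sum xpredT 1 = 1.
Proof. by rewrite /harmonic_sum big_nat1 invr1. Qed.

Lemma harmonic_sum_le n : (0 < n)%N -> harmonic_sum xpredT n <= 1 + ln n%:R.
Proof.
elim: n => // -[_ _|n /(_ isT) IH _]; first by rewrite harmonic_sum1 ln1 addr0.
rewrite harmonic_sumS.
have := @ln_succ_ge n.+1%:R; rewrite ltr0n natr1 => /(_ isT).
by move: IH; move: n.+2%:R n.+1%:R => x y; lra.
Qed.

Lemma harmonic_sum_ge n : (0 < n)%N -> ln n%:R <= harmonic_sum xpredT n.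
Proof.
move=> n0; apply: (@le_trans _ _ (ln n.+1%:R)).
  by rewrite ler_ln ?posrE ?ltr0n // ler_nat.
elim: n n0 => // -[_ _|n /(_ isT) IH _].
  by have := @ln_succ_le 1; rewrite harmonic_sum1 ln1 subr0 invr1; apply.
rewrite harmonic_sumS.
have := @ln_succ_le n.+2%:R; rewrite ltr0n natr1 => /(_ isT).
by move: IH; move: n.+3%:R n.+2%:R => x y; lra.
Qed.

Lemma harmonic_sumC P n :
  harmonic_sum xpredT n = harmonic_sum P n + harmonic_sum (predC P) n.
Proof. by rewrite /harmonic_sum (bigID P). Qed.

Lemma le_harmonic_sum P Q n : (forall k, P k -> Q k) ->
  harmonic_sum P n <= harmonic_sum Q n.
Proof.
move=> PQ; rewrite /harmonic_sum big_mkcond [leRHS]big_mkcond.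
apply: ler_sum => k _; case: (boolP (P k)) => [/PQ ->//|_].
by case: (Q k).
Qed.

Lemma harmonic_sum_periodic_le P L n :
  (0 < L)%N -> (0 < n)%N -> (forall i, P (i + L)%N = P i) ->
  harmonic_sum P n <= freq R L P * ln n%:R + L.+2%:R.
Proof.
move=> L0 n0 PL.
have := @sum_periodic_le (fun k => k%:R^-1) P L n L0 PL.
rewrite invr1 mulr1 => /(_ _ _)/le_trans; apply => [k|k|].
- by rewrite invr_ge0.
- by rewrite lef_pV2 ?posrE ?ltr0n // ler_nat.
have := harmonic_sum_le n0; rewrite /harmonic_sum => h.
have f0 := freq_ge0 R L P; have f1 := freq_le1 R L P.
have := ler_wpM2l f0 h; rewrite -[L.+2%:R]natr1; lra.
Qed.

(** The upper bound for the complement of P is subtracted from the full harmonic sum, which is at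
    least ln n. *)
Lemma harmonic_sum_periodic_ge P L n :
  (0 < L)%N -> (0 < n)%N -> (forall i, P (i + L)%N = P i) ->
  freq R L P * ln n%:R - L.+2%:R <= harmonic_sum P n.
Proof.
move=> L0 n0 PL.
have := harmonic_sum_periodic_le (P := predC P) L0 n0.
rewrite freqN // => /(_ _) h.
have := harmonic_sum_ge n0; rewrite (harmonic_sumC P).
have : harmonic_sum (predC P) n <= (1 - freq R L P) * ln n%:R + L.+2%:R.
  by apply: h => i /=; rewrite PL.
lra.
Qed.

(** The constant may depend on e, since ln n eventually absorbs it; in the application e determines
    a finite part of B and C its period. *)
Lemma cvg_log_average (S : nat -> R) (l : R) :
  (forall e, 0 < e -> exists C, forall n, (1 < n)%N ->
     `|S n - l * ln n%:R| <= e * ln n%:R + C) ->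
  (fun n => (ln n%:R)^-1 * S n) @ \oo --> l.
Proof.
move=> H; apply/cvgrPdist_le => e e0.
have [C HC] := H (e / 2) (divr_gt0 e0 (ltr0n _ 2)).
near=> n.
have n1 : (1 < n)%N by near: n; exact: nbhs_infty_gt.
have ln0 : 0 < ln n%:R :> R by rewrite ln_gt0 // ltr1n.
rewrite distrC -(ler_pM2r ln0) -[X in _ * X <= _](gtr0_norm ln0) -normrM.
rewrite mulrBl mulrAC mulVf ?gt_eqF // mul1r.
apply: (le_trans (HC n n1)).
suff : C <= e / 2 * ln n%:R by lra.
rewrite mulrC -ler_pdivrMr ?divr_gt0 // -[leLHS]expRK.
rewrite ler_ln ?posrE ?expR_gt0 ?ltr0n; last exact: ltnW.
apply: ltW; near: n.
have := nbhs_infty_gt (Num.truncn (expR (C / (e / 2)))) => h.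
near=> n; apply: lt_le_trans (truncnS_gt _) _.
by rewrite ler_nat; near: n.
Unshelve. all: by end_near. Qed.

End LogSums.

(** * Partial sums of k^(-1-t) *)

Section Dirichlet.
Variables (R : realType) (t : R).
Hypothesis t0 : 0 < t.

(** This is k^(-s) for k > 0; in exponential form it is positive at every k, 0 included. *)
Definition npow (s : R) (k : nat) : R := expR (- s * ln k%:R).

Lemma npow_gt0 s k : 0 < npow s k. Proof. exact: expR_gt0. Qed.

Lemma npow_ge0 s k : 0 <= npow s k. Proof. exact: expR_ge0. Qed.

Lemma npow1 s : npow s 1 = 1. Proof. by rewrite /npow ln1 mulr0 expR0. Qed.

Lemma npowM s a b : (0 < a)%N -> (0 < b)%N -> npow s (a * b) = npow s a * npow s b.
Proof. by move=> a0 b0; rewrite /npow natrM lnM ?posrE ?ltr0n // mulrDr expRD. Qed.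

Lemma npowD s s' k : npow (s + s') k = npow s k * npow s' k.
Proof. by rewrite /npow opprD mulrDl expRD. Qed.

Lemma npow_inv k : (0 < k)%N -> npow 1 k = k%:R^-1.
Proof. by move=> k0; rewrite /npow mulN1r expRN lnK // posrE ltr0n. Qed.

Lemma npow_noninc s k : 0 <= s -> npow s k.+2 <= npow s k.+1.
Proof.
move=> s0; rewrite ler_expR !mulNr lerN2 ler_wpM2l //.
by rewrite ler_ln ?posrE ?ltr0n // ler_nat.
Qed.

Lemma npow_weight_multiplicative s : multiplicative_weight (fun _ g => npow s g).
Proof.
move=> a b x y a0 b0 _ xa yb.
by rewrite npowM // ?(dvdn_gt0 a0 xa) ?(dvdn_gt0 b0 yb).
Qed.

Let u := npow (1 + t).
Let v := npow t.

(** Discrete form of integrating x^(-1-t), from 1 + x <= exp x. Together with [npow_telescope_le] it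
    places the sum of [u] up to n between (1 - v (n + 1)) / t and 1 + 1 / t. *)
Lemma npow_telescope_ge k : (0 < k)%N -> v k - v k.+1 <= t * u k.
Proof.
move=> k0; have kR : 0 < k%:R :> R by rewrite ltr0n.
have -> : v k.+1 = v k * expR (- t * (ln k.+1%:R - ln k%:R)).
  by rewrite /v /npow -expRD -mulrDr; congr (expR (_ * _)); ring.
rewrite /u npowD npow_inv // -/(v k).
have h : 1 - t * k%:R^-1 <= expR (- t * (ln k.+1%:R - ln k%:R)).
  apply: le_trans (expR_ge1Dx _); rewrite mulNr lerD2l lerN2 ler_pM2l //.
  by rewrite -natr1; exact: ln_succ_le.
have := ler_wpM2l (npow_ge0 t k) h; rewrite -/(v k).
move: (expR _) (k%:R^-1) (v k) => x y z; nra.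
Qed.

Lemma npow_telescope_le k : (0 < k)%N -> t * u k.+1 <= v k - v k.+1.
Proof.
move=> k0; have kR : 0 < k%:R :> R by rewrite ltr0n.
have -> : v k = v k.+1 * expR (t * (ln k.+1%:R - ln k%:R)).
  by rewrite /v /npow -expRD; congr expR; ring.
rewrite /u npowD npow_inv // -/(v k.+1).
have h : 1 + t * k.+1%:R^-1 <= expR (t * (ln k.+1%:R - ln k%:R)).
  apply: le_trans (expR_ge1Dx _); rewrite lerD2l ler_pM2l //.
  by rewrite -natr1; exact: ln_succ_ge.
have := ler_wpM2l (npow_ge0 t k.+1) h; rewrite -/(v k.+1).
move: (expR _) (k.+1%:R^-1) (v k.+1) => x y z; nra.
Qed.

Let U n := \sum_(1 <= k < n.+1) u k.

Let US n : U n.+1 = U n + u n.+1.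
Proof. by rewrite /U big_nat_recr. Qed.

Lemma sum_npow_ge n : 1 - v n.+1 <= t * \sum_(1 <= k < n.+1) u k.
Proof.
rewrite -/(U n); elim: n => [|n IH].
  by rewrite /v npow1 subrr /U big_geq // mulr0.
rewrite US mulrDr; have := npow_telescope_ge (ltn0Sn n); move: IH.
move: (U n) (v n.+1) (v n.+2) (u n.+1) => a b c d; lra.
Qed.

Lemma sum_npow_le n : \sum_(1 <= k < n.+1) u k <= 1 + t^-1.
Proof.
suff : t * U n <= t + 1.
  by rewrite mulrC -ler_pdivlMr // mulrDl divff ?gt_eqF // mul1r.
case: n => [|n]; first by rewrite /U big_geq // mulr0 addr_ge0 // ltW.
suff : t * U n.+1 <= t + 1 - v n.+1.
  by move/le_trans; apply; rewrite gerBl npow_ge0.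
elim: n => [|n IH]; first by rewrite /U big_nat1 /u /v !npow1 mulr1 addrK.
rewrite US mulrDr; have := npow_telescope_le (ltn0Sn n); move: IH.
move: (U n.+1) (v n.+1) (v n.+2) (u n.+2) => a b c d; lra.
Qed.

End Dirichlet.

(** * Sums over intervals and over divisors *)

Section SumSub.
Variable R : realType.

Lemma sum_seq_sub (s s' : seq nat) (f : nat -> R) (P Q : pred nat) :
  uniq s -> uniq s' -> (forall k, 0 <= f k) ->
  (forall k, k \in s -> P k -> k \in s' /\ Q k) ->
  \sum_(k <- s | P k) f k <= \sum_(k <- s' | Q k) f k.
Proof.
move=> us us' f0 sub; rewrite -big_filter -[leRHS]big_filter.
have perm : perm_eq [seq k <- s' | Q k]
   ([seq k <- s | P k] ++ [seq k <- s' | Q k & (k \notin s) || ~~ P k]).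
  apply: uniq_perm => [||k]; rewrite ?filter_uniq // ?cat_uniq ?filter_uniq //=.
    rewrite andbT; apply/hasPn => k; rewrite !mem_filter => /andP[/andP[_ h] _].
    by rewrite negb_and orbC.
  rewrite mem_cat !mem_filter.
  have := sub k; case: (k \in s); case: (P k) => //= h; last 3 first.
  - by rewrite andbT.
  - by rewrite andbT.
  - by rewrite andbT.
  by have [-> ->] := h isT isT.
by rewrite (perm_big _ perm) big_cat /= lerDl sumr_ge0.
Qed.

Lemma sum_divisors_le (f : nat -> R) (P : pred nat) N : (0 < N)%N ->
  (forall k, 0 <= f k) ->
  \sum_(k <- divisors N | P k) f k <= \sum_(1 <= k < N.+1 | P k) f k.
Proof.
move=> N0 f0; apply: sum_seq_sub; rewrite ?divisors_uniq ?iota_uniq // => k.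
rewrite -dvdn_divisors // mem_index_iota ltnS => kN ->.
by rewrite (dvdn_gt0 N0) // dvdn_leq.
Qed.

(** Every positive integer up to X divides X!, so an initial interval embeds in a divisor lattice,
    where Harris' inequality is available. *)
Lemma sum_divisors_fact_ge (f : nat -> R) (P : pred nat) n X : (n <= X)%N ->
  (forall k, 0 <= f k) ->
  \sum_(1 <= k < n.+1 | P k) f k <= \sum_(k <- divisors X`! | P k) f k.
Proof.
move=> nX f0; apply: sum_seq_sub; rewrite ?divisors_uniq ?iota_uniq // => k.
rewrite -dvdn_divisors ?fact_gt0 // mem_index_iota ltnS => /andP[k0 kn] ->.
by rewrite dvdn_fact // k0 (leq_trans kn).
Qed.

End SumSub.

(** * Sieving with the weights k^(-s) *)

Section DavenportErdos.
Variable R : realType.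

(* Harris' inequality compares the weight k^(-s) with the distribution of
   gcd(i, N) for i uniform modulo N: their ratio is monotone for divisibility. *)
Lemma sum_npow_avoids (t : R) (N : nat) (T : seq nat) : 0 <= t -> (0 < N)%N ->
  {in T, forall a, (a %| N)%N} ->
  free_density R T * \sum_(k <- divisors N) npow (1 + t) k <=
  \sum_(k <- divisors N | avoids T k) npow (1 + t) k.
Proof.
move=> t0 N0 TN; pose u := npow (1 + t).
pose g x : R := (totient (N %/ x))%:R / u x.
have gm : {in divisors N &, forall x y, (x %| y)%N -> g x <= g y}.
  move=> x y; rewrite -!dvdn_divisors // => xN yN /dvdnP[a yE].
  have x0 := dvdn_gt0 N0 xN; have y0 := dvdn_gt0 N0 yN.
  have a0 : (0 < a)%N by move: y0; rewrite yE muln_gt0 => /andP[].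
  have [b NE] := dvdnP yN; have b0 : (0 < b)%N by move: N0; rewrite NE muln_gt0 => /andP[].
  (* With y = a x and N = b y, the claim reduces to totient (a b) <= totient b / u a, which follows
     from totient (a b) <= a totient b and u a <= 1 / a. *)
  have -> : g y = (totient b)%:R * (u a)^-1 / u x.
    by rewrite /g NE mulnK // yE /u npowM // invfM mulrA.
  rewrite /g ler_wpM2r ?invr_ge0 ?npow_ge0 //.
  have -> : (N %/ x = a * b)%N by rewrite NE yE mulnA mulnK // mulnC.
  apply: (@le_trans _ _ (a%:R * (totient b)%:R)).
    by rewrite -natrM ler_nat totient_mul_le.
  rewrite mulrC ler_wpM2l // /u npowD npow_inv // invfM invrK.
  rewrite ler_peMr // invf_ge1 ?npow_gt0 // -(expR0 R) ler_expR mulNr oppr_le0.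
  by rewrite mulr_ge0 // ln_ge0 // ler1n.
have av : {in divisors N &, forall x y, (x %| y)%N ->
    - (avoids T x)%:R <= - (avoids T y)%:R :> R}.
  move=> x y _ _ /(avoids_dvd (T := T)); rewrite lerN2 ler_nat.
  by case: (avoids T y) => // ->.
have := harris_divisors (fun _ _ => npow_ge0 (1 + t) _)
  (npow_weight_multiplicative (1 + t)) N0 av gm.
rewrite -/u.
(* The weight [u] cancels the denominator of [g], leaving two totient sums: N, and N times the free
   density of T. *)
under eq_bigr do rewrite mulrN.
under [X in _ * X <= _]eq_bigr => x _.
  rewrite /g mulrC divfK ?gt_eqF ?npow_gt0 //.
  over.
under [X in _ <= _ * X]eq_bigr => x _.
  rewrite mulNr mulrN mulrCA /g [u x * _]mulrC divfK ?gt_eqF ?npow_gt0 // mulrC.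
  over.
rewrite !sumrN mulNr mulrN lerN2 sum_totient_divisors // -free_densityE_totient //.
rewrite mulrCA [leRHS]mulrC ler_pM2l ?ltr0n // mulrC.
move/le_trans; apply; rewrite [leRHS]big_mkcond; apply: ler_sum => x _.
by case: (avoids T x); rewrite ?mulr1 ?mulr0.
Qed.

(* With s = 1 + 1 / ln n, one has 1/k <= e k^(-s) for k <= n; the sum over k <= n
   is then enlarged to the divisors of X!, where X is so large that the sum of k^(-s)
   over these divisors lies within 1 of ln n. *)
Theorem davenport_erdos (A M : pred nat) (T : seq nat) (kappa : R) n :
  all_positive T -> (forall a, A a -> (0 < a)%N) -> {in T, forall a, A a} ->
  (forall k, reflect (exists2 a, A a & (a %| k)%N) (M k)) ->
  0 <= kappa ->
  (forall S, {in S, forall a, A a} -> kappa <= free_density R S) -> (1 < n)%N ->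
  harmonic_sum R (fun k => M k && avoids T k) n <=
  expR 1 * ((free_density R T - kappa) * ln n%:R + (\prod_(a <- T) a)%N%:R + 3%:R).
Proof.
move=> pT A0 TA MP k0 kap n1; set L := (\prod_(a <- T) a)%N.
have L0 : (0 < L)%N by exact: positive_prod.
have lnn : 0 < ln n%:R :> R by rewrite ln_gt0 // ltr1n.
pose t : R := (ln n%:R)^-1; have t0 : 0 < t by rewrite invr_gt0.
pose u := npow (1 + t).
have u0 k : 0 <= u k by exact: npow_ge0.
(* X + 1 exceeds exp ((ln n)^2), so t ln (X + 1) >= ln n and the tail term npow t (X + 1) is at most
   1 / n. *)
pose X := (n + Num.truncn (expR (ln n%:R * ln n%:R : R)))%N.
have nX : (n <= X)%N by exact: leq_addr.
have vX : ln n%:R * npow t X.+1 <= 1.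
  have h : ln n%:R <= t * ln X.+1%:R.
    rewrite mulrC ler_pdivlMr // -[leLHS]expRK ler_ln ?posrE ?expR_gt0 ?ltr0n //.
    apply: le_trans (ltW (truncnS_gt _)) _.
    by rewrite ler_nat ltnS leq_addl.
  apply: (@le_trans _ _ (ln n%:R * expR (- ln n%:R))).
    by rewrite ler_pM2l // ler_expR mulNr lerN2.
  rewrite expRN lnK ?posrE ?ltr0n 1?ltnW // ler_pdivrMr ?ltr0n 1?ltnW // mul1r.
  by apply: ltW; apply: ln_sublinear; rewrite ltr0n ltnW.
pose N := X`!; have N0 : (0 < N)%N by exact: fact_gt0.
pose Z := \sum_(k <- divisors N) u k.
have Zge : ln n%:R - 1 <= Z.
  have : \sum_(1 <= k < X.+1) u k <= Z.
    exact: (sum_divisors_fact_ge xpredT (leqnn X) u0).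
  have := sum_npow_ge t0 X.
  rewrite -(ler_pM2l lnn) mulrA divff ?gt_eqF // mul1r mulrBr mulr1 -/u.
  move: vX; move: (ln _) (\sum_(_ <= _ < _) _) (npow _ _) => a b c; lra.
(* On divisors of N, being free of the finite list [S] is the same as lying outside [M], so [kappa]
   bounds the relevant free density. *)
pose S := [seq a <- divisors N | A a].
have SA : {in S, forall a, A a} by move=> a; rewrite mem_filter => /andP[].
have SN : {in S, forall a, (a %| N)%N}.
  by move=> a; rewrite mem_filter -dvdn_divisors // => /andP[].
have MS k : (k %| N)%N -> avoids S k = ~~ M k.
  move=> kN; apply/allP/negP => [H /MP [a Aa ak]|H a aS].
    have : a \in S by rewrite mem_filter Aa -dvdn_divisors // (dvdn_trans ak).
    by move=> /H; rewrite ak.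
  by apply/negP => ak; apply: H; apply/MP; exists a => //; apply: SA.
have low : kappa * Z <= \sum_(k <- divisors N | ~~ M k) u k.
  apply: (@le_trans _ _ (free_density R S * Z)).
    by rewrite ler_wpM2r ?kap // sumr_ge0.
  apply: le_trans (sum_npow_avoids (ltW t0) N0 SN) _.
  rewrite big_seq_cond [leRHS]big_seq_cond le_eqVlt; apply/orP; left; apply/eqP.
  apply: eq_bigl => k; case kN: (k \in divisors N) => //=.
  by rewrite MS // dvdn_divisors.
have up : \sum_(k <- divisors N | avoids T k) u k <=
    L.+1%:R + free_density R T * (1 + ln n%:R).
  apply: le_trans (sum_divisors_le _ N0 u0) _.
  apply: le_trans (sum_periodic_le (L := L) _ L0 _ u0 _) _.
  - exact/avoids_periodic/dvdn_prod_seq.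
  - by move=> k; apply: npow_noninc; rewrite addr_ge0 // ltW.
  rewrite /u npow1 mulr1 lerD2l -/(free_density R T).
  by rewrite ler_wpM2l ?free_density_ge0 // -[ln _]invrK sum_npow_le.
have split_T : \sum_(k <- divisors N | avoids T k) u k =
  \sum_(k <- divisors N | M k && avoids T k) u k +
  \sum_(k <- divisors N | ~~ M k) u k.
  rewrite (bigID M) /=; congr (_ + _); apply: eq_bigl => k; first exact: andbC.
  case: (boolP (M k)) => [_|Mk]; first by rewrite andbF.
  rewrite andbT; apply/allP => a aT; apply: contra Mk => ak.
  by apply/MP; exists a => //; apply: TA.
apply: (@le_trans _ _ (expR 1 * \sum_(k <- divisors N | M k && avoids T k) u k)).
  apply: (@le_trans _ _ (expR 1 * \sum_(1 <= k < n.+1 | M k && avoids T k) u k)).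
    rewrite /harmonic_sum mulr_sumr big_nat_cond [leRHS]big_nat_cond.
    apply: ler_sum => k /andP[/andP[k1 kn] _].
    rewrite /u npowD npow_inv // mulrCA ler_peMr ?invr_ge0 // -expRD -[leLHS]expR0.
    rewrite ler_expR mulNr subr_ge0 ler_pdivrMl // mulr1.
    by rewrite ler_ln ?posrE ?ltr0n // ?ler_nat // ltnW.
  by rewrite ler_pM2l ?expR_gt0 // sum_divisors_fact_ge.
rewrite ler_pM2l ?expR_gt0 //.
(* The constant 3 collects the 1 of L + 1, the free density of T and [kappa], each at most 1. *)
have f1 : free_density R T <= 1 by exact: free_density_le1.
have kap1 : kappa <= 1 by rewrite -(free_density_nil R) kap.
have := ler_wpM2l k0 Zge.
move: up low; rewrite split_T -(natr1 L).
move: (\sum_(_ <- _ | _) _) (\sum_(_ <- _ | _) _) => a b; lra.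
Qed.

End DavenportErdos.

Definition seq_within (T : seq nat) (B : set nat) : Prop := {in T, forall a, B a}.

Definition quotient_set (d : nat) (B : set nat) : set nat := [set a | B (d * a)%N].

(** * Tautness *)

Section Taut.
Variable R : realType.
Implicit Types (B : set nat) (T : seq nat).

Local Notation fd := (free_density R).

(** By [log_density_multiples], this is the logarithmic density of the B-free integers when B
    consists of positive numbers. *)
Definition inf_density B : R := inf [set fd T | T in [set T | seq_within T B]].

(* B is not a Behrend set. *)
Definition inf_density_pos B : Prop :=
  exists2 c : R, 0 < c & forall T, seq_within T B -> c <= fd T.

Lemma within_positive T B : (forall b, B b -> (0 < b)%N) -> seq_within T B -> all_positive T.
Proof. by move=> Bpos TB; apply/allP => t /TB/Bpos. Qed.

Lemma inf_density_le B T : seq_within T B -> inf_density B <= fd T.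
Proof.
move=> TB; apply: ge_inf; last by exists T.
by exists 0 => _ [S _ <-]; apply: free_density_ge0.
Qed.

Lemma has_inf_density B : has_inf [set fd T | T in [set T | seq_within T B]].
Proof.
split; first by exists (fd [::]), [::].
by exists 0 => _ [S _ <-]; apply: free_density_ge0.
Qed.

Lemma inf_density_ge0 B : 0 <= inf_density B.
Proof.
apply: lb_le_inf; first exact: (has_inf_density B).1.
by move=> _ [T _ <-]; apply: free_density_ge0.
Qed.

Lemma inf_density_adherent B (e : R) : 0 < e ->
  exists2 T, seq_within T B & fd T < inf_density B + e.
Proof.
by move=> e0; have [_ [T TB <-] h] := inf_adherent e0 (has_inf_density B); exists T.
Qed.

Definition in_multiples B : pred nat := fun k => (k%:Z : int) \in multiples B.

Lemma in_multiplesP B k :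
  reflect (exists2 a, a \in B & (a %| k)%N) (in_multiples B k).
Proof.
apply: (iffP idP) => [/set_mem[a Ba]|[a /set_mem Ba ak]].
  by rewrite dvdzE !absz_nat => ak; exists a => //; apply: mem_set.
by apply/mem_set; exists a => //; rewrite dvdzE !absz_nat.
Qed.

Lemma harmonic_sum_multiples_le B T n : (forall b, B b -> (0 < b)%N) ->
  seq_within T B -> (1 < n)%N ->
  harmonic_sum R (fun k => in_multiples B k && avoids T k) n <=
  expR 1 * ((fd T - inf_density B) * ln n%:R + (\prod_(a <- T) a)%N%:R + 3%:R).
Proof.
move=> Bpos TB n1; apply: (davenport_erdos (A := fun a => a \in B)) => //.
- exact: within_positive TB.
- by move=> a /set_mem/Bpos.
- by move=> a /TB/mem_set.
- exact: in_multiplesP.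
- exact: inf_density_ge0.
- by move=> S SB; apply: inf_density_le => a /SB/set_mem.
Qed.

(** The multiples of a finite T within B are periodic; the other multiples of B have harmonic sum at
    most exp 1 (fd T - inf_density B) ln n plus a constant, by the Davenport-Erdos estimate. *)
Lemma log_density_multiples B : (forall b, B b -> (0 < b)%N) ->
  log_density R (multiples B) = 1 - inf_density B.
Proof.
move=> Bpos; apply: cvg_lim => //.
apply: (@cvg_log_average R (fun n => harmonic_sum R (in_multiples B) n)) => e e0.
have E0 : 0 < expR 1 :> R by exact: expR_gt0.
(* The lower error is e' ln n and the upper one exp 1 times as large, up to constants; e' is chosen
   so that their sum is e ln n. *)
pose e' := e / (1 + expR 1).
have e'0 : 0 < e' by rewrite divr_gt0 // addr_gt0.
have [T TB fT] := inf_density_adherent B e'0.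
have kT := inf_density_le TB.
have pT := within_positive Bpos TB.
pose L := (\prod_(a <- T) a)%N.
have L0 : (0 < L)%N by exact: positive_prod.
have per i : predC (avoids T) (i + L)%N = predC (avoids T) i.
  by rewrite /= avoids_periodic //; apply: dvdn_prod_seq.
exists (L.+2%:R + expR 1 * (L%:R + 3%:R)) => n n1.
have n0 : (0 < n)%N by exact: ltnW.
have lnn : 0 <= ln n%:R :> R by rewrite ln_ge0 // ler1n.
have := harmonic_sum_multiples_le Bpos TB n1; rewrite -/L.
have := harmonic_sum_periodic_le R L0 n0 per.
have := harmonic_sum_periodic_ge R L0 n0 per.
rewrite freqN // -/(fd T).
have low : harmonic_sum R (predC (avoids T)) n <= harmonic_sum R (in_multiples B) n.
  apply: le_harmonic_sum => k /allPn[a aT]; rewrite negbK => ak.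
  by apply/in_multiplesP; exists a => //; apply/mem_set/TB.
have up : harmonic_sum R (in_multiples B) n <=
    harmonic_sum R (fun k => in_multiples B k && avoids T k) n +
    harmonic_sum R (predC (avoids T)) n.
  rewrite /harmonic_sum (bigID (avoids T)) /= lerD2l.
  by apply: le_harmonic_sum => k /andP[].
move: low up; move: (harmonic_sum _ _ _) (harmonic_sum _ _ _) (harmonic_sum _ _ _).
move=> a b c ab bc a_ge a_le c_le.
have eE : e' + expR 1 * e' = e by rewrite /e'; field; rewrite gt_eqF // addr_gt0.
have h1 : (fd T - inf_density B) * ln n%:R <= e' * ln n%:R.
  by rewrite ler_wpM2r //; lra.
have h2 := ler_wpM2l (ltW E0) h1.
have h3 : 0 <= expR 1 * e' * ln n%:R by rewrite !mulr_ge0 // ltW.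
have h4 : 0 <= expR 1 * (L%:R + 3%:R) :> R.
  by rewrite mulr_ge0 ?addr_ge0 // ltW.
have h5 : 0 <= (fd T - inf_density B) * ln n%:R by rewrite mulr_ge0 // subr_ge0.
have h6 : 0 <= e' * ln n%:R by rewrite mulr_ge0 // ltW.
rewrite -eE ler_norml.
move: h1 h2 h3 h4 h5 h6 c_le a_le a_ge {kT fT eE e'0}.
move: (ln _) (expR 1) (fd T) (inf_density B) (L.+2%:R) (L%:R).
move=> x E f k l2 l h1 h2 h3 h4 h5 h6; lra.
Qed.

Lemma tautP B : (forall b, B b -> (0 < b)%N) ->
  taut R B <-> (forall b, B b -> inf_density B < inf_density (B `\ b)).
Proof.
move=> Bpos.
have E b : (log_density R (multiples (B `\ b)) < log_density R (multiples B)) =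
    (inf_density B < inf_density (B `\ b)).
  rewrite !log_density_multiples //; last by move=> a [/Bpos].
  by rewrite ltrD2l ltrN2.
by split=> H b Bb; have := H b Bb; rewrite E.
Qed.

Lemma inf_densityPn B : ~ inf_density_pos B ->
  forall e : R, 0 < e -> exists2 T, seq_within T B & fd T < e.
Proof.
move=> nB e e0; apply: contrapT => H; apply: nB; exists e => // T TB.
by rewrite leNgt; apply/negP => fT; apply: H; exists T.
Qed.

(* If {a : d a in B} were Behrend, it would remain so after removing one of its
   elements a > 1, and d a could be removed from B without changing the density. *)
Lemma taut_quotient B d : (forall b, B b -> (0 < b)%N) -> taut R B ->
  (0 < d)%N -> ~ B d -> inf_density_pos (quotient_set d B).
Proof.
move=> Bpos /(tautP Bpos) tB d0 Bd; apply: contrapT => /inf_densityPn small.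
have Qpos a : quotient_set d B a -> (0 < a)%N.
  by move/Bpos; rewrite muln_gt0 => /andP[].
have [a Ba] : exists a, quotient_set d B a.
  have [[|a T] TB] := small 1 ltr01; first by rewrite free_density_nil ltxx.
  by exists a; apply: TB; apply: mem_head.
have a1 : (1 < a)%N.
  rewrite ltn_neqAle Qpos // andbT; apply/eqP => a1; apply: Bd.
  by move: Ba; rewrite /quotient_set /= -a1 muln1.
have := tB _ Ba; apply/negP; rewrite -leNgt; apply/ler_addgt0Pr => e e0.
(* The budget is e = e/2 + 2 (e/4): removing [a] from the list at most doubles its free density. *)
have [T TB fT] := inf_density_adherent B (divr_gt0 e0 (ltr0n _ 2)).
have [T1 T1B fT1] := small (e / 4) (divr_gt0 e0 (ltr0n _ 4)).
pose T2 := [seq x <- T1 | x != a].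
have pT := within_positive Bpos TB.
have pT1 := within_positive Qpos T1B.
have pT2 : all_positive T2.
  by apply: (positive_sub (T' := T1)) => // x; rewrite mem_filter => /andP[].
have fT2 : fd T2 <= 2 * fd T1.
  have p : all_positive ([:: a] ++ T2) by rewrite positive_cat pT2 /= Qpos.
  have h : fd [:: a] * fd T2 <= fd T1.
    apply: le_trans (free_density_cat R p) (free_density_sub R p _) => x xT1.
    by rewrite mem_cat inE mem_filter xT1 andbT; case: eqP.
  have a2 : 2^-1 <= fd [:: a].
    rewrite free_density1 ?Qpos //.
    suff : a%:R^-1 <= 2^-1 :> R by lra.
    by rewrite lef_pV2 ?posrE ?ltr0n ?ler_nat // Qpos.
  have := ler_wpM2r (free_density_ge0 R T2) a2; lra.
pose T' := [seq t <- T | t != (d * a)%N] ++ [seq (d * t)%N | t <- T2].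
have T'B : seq_within T' (B `\ (d * a)%N).
  move=> t; rewrite mem_cat mem_filter => /orP[/andP[/eqP tda /TB Bt]|] //.
  move=> /mapP[s]; rewrite mem_filter => /andP[sa sT1] ->; split; first exact: T1B.
  by move=> /eqP; rewrite eqn_pmul2l // (negbTE sa).
apply: (le_trans (inf_density_le T'B)).
pose L := (d * a * \prod_(t <- T ++ T') t)%N.
have pT' : all_positive T' by apply: within_positive T'B => b [/Bpos].
have L0 : (0 < L)%N.
  by rewrite !muln_gt0 d0 Qpos //= positive_prod // positive_cat pT.
have LT t : t \in T ++ T' -> (t %| L)%N.
  by move=> tT; rewrite dvdn_mull // dvdn_prod_seq.
have dT2 t : t \in T2 -> (d * t %| L)%N.
  by move=> tT; apply: LT; rewrite !mem_cat map_f ?orbT.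
rewrite -(free_densityE R L0) => [|t tT]; last by rewrite LT // mem_cat tT orbT.
(* An integer free of [T'] but not of [T] is a multiple of d a, hence of d, and avoids all d t with
   t in [T2]. *)
apply: (@le_trans _ _ (fd T + fd T2 / d%:R)).
  rewrite -(free_density_map_mul R d0 L0 pT2 dT2); last by rewrite /L -mulnA dvdn_mulr.
  rewrite -(free_densityE R (T := T) L0) => [|t tT]; last by rewrite LT // mem_cat tT.
  apply: freq_le_split => i; rewrite /avoids all_cat => /andP[Ti ->].
  rewrite andbT orbC; have [//|di] := boolP (d %| i)%N; apply/allP => t tT.
  have [->|tda] := eqVneq t (d * a)%N.
    by apply: contra di; apply: dvdn_trans; apply: dvdn_mulr.
  by apply: (allP Ti); rewrite mem_filter tda.
have : fd T2 / d%:R <= fd T2.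
  by rewrite ler_pdivrMr ?ltr0n // ler_peMr ?free_density_ge0 // ler1n.
move: fT fT1 fT2; move: (fd T2 / d%:R) (fd T) (fd T1) (fd T2) => g f f1 f2; lra.
Qed.

(** The product bounding the sieved progression runs over the divisors of gcd(n, l), so one constant
    per divisor gives a bound uniform in T. *)
Lemma progression_inf_density_pos B n l : (forall b, B b -> (0 < b)%N) ->
  (0 < l)%N ->
  (forall d, (0 < d)%N -> (d %| gcdn n l)%N -> inf_density_pos (quotient_set d B)) ->
  exists2 c : R, 0 < c & forall T L, seq_within T B -> (0 < L)%N -> (l %| L)%N ->
    {in T, forall t, (t %| L)%N} ->
    c <= freq R L (fun i => (i == n %[mod l]) && avoids T i).
Proof.
move=> Bpos l0 H.
have /choice[c cP] d : exists c : R, 0 < c /\ ((0 < d)%N -> (d %| gcdn n l)%N ->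
    forall T, seq_within T (quotient_set d B) -> c <= fd T).
  have [/andP[d0 dn]|nd] := boolP ((0 < d)%N && (d %| gcdn n l)%N).
    by have [c c0 cT] := H d d0 dn; exists c.
  by exists 1; split=> // d0 dn; move: nd; rewrite d0 dn.
have g0 : (0 < gcdn n l)%N by rewrite gcdn_gt0 l0 orbT.
exists ((\prod_(d <- divisors (gcdn n l)) c d) / l%:R).
  by rewrite divr_gt0 ?ltr0n // prodr_gt0 // => d _; case: (cP d).
move=> T L TB L0 lL TL.
apply: le_trans (progression_free_density R n l0 L0 (within_positive Bpos TB) lL TL).
rewrite ler_wpM2r ?invr_ge0 // big_seq [leRHS]big_seq.
apply: ler_prod => d; rewrite -dvdn_divisors // => dg.
have [c0 cT] := cP d; rewrite (ltW c0) /=; apply: cT => //.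
  exact: dvdn_gt0 dg.
by move=> a /quotientsP -/(_ (dvdn_gt0 g0 dg)) /TB.
Qed.

(** Otherwise no proper divisor of b has a Behrend quotient, and the multiples of b free of the rest
    of B keep a proportion c > 0 under every finite sieve. Adding b would then lower [inf_density]
    by at least c, contradicting the choice of b. *)
Lemma not_taut_quotient B : (forall b, B b -> (0 < b)%N) -> primitive B ->
  ~ taut R B -> exists b d, [/\ B b, (d %| b)%N, d <> b &
    ~ inf_density_pos (quotient_set d B)].
Proof.
move=> Bpos Bprim /(tautP Bpos) /existsNP[b] /not_implyP[Bb] /negP.
rewrite -leNgt => kb; apply: contrapT => H.
have b0 := Bpos _ Bb.
have Bpos' a : (B `\ b) a -> (0 < a)%N by move=> [/Bpos].
have quot d : (0 < d)%N -> (d %| gcdn 0 b)%N -> inf_density_pos (quotient_set d (B `\ b)).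
  (* For d = b the quotient set is empty by primitivity, and the empty list has free density 1. *)
  move=> d0; rewrite gcd0n => db; have [->|dneb] := eqVneq d b.
    exists 1 => // -[|a T] TB; first by rewrite free_density_nil.
    have [Bba /= ne] := TB a (mem_head _ _).
    by case: ne; rewrite -(Bprim _ _ Bb Bba) // dvdn_mulr.
  have [c c0 cT] : inf_density_pos (quotient_set d B).
    by apply: contrapT => nd; apply: H; exists b, d; split=> //; apply/eqP.
  by exists c => // T TB; apply: cT => a /TB[].
have [c c0 cT] := progression_inf_density_pos Bpos' b0 quot.
have [T TB fT] := inf_density_adherent (B `\ b) c0.
have bTB : seq_within (b :: T) B.
  by move=> a; rewrite inE => /orP[/eqP ->//|/TB[]].
pose L := (\prod_(t <- b :: T) t)%N.
have pbT := within_positive Bpos bTB.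
have L0 : (0 < L)%N by exact: positive_prod.
have LT : {in b :: T, forall t, (t %| L)%N} by exact: dvdn_prod_seq.
have TL : {in T, forall t, (t %| L)%N} by move=> t tT; rewrite LT // inE tT orbT.
have := cT T L TB L0 (LT _ (mem_head _ _)) TL.
have := inf_density_le bTB; rewrite -(free_densityE R L0 LT).
(* The integers not free of b :: T split into the multiples of b that avoid T and the multiples of
   elements of T. *)
have := freqN R (fun i => (i == 0 %[mod b]) && avoids T i || ~~ avoids T i) L0.
have -> : freq R L (avoids (b :: T)) =
   freq R L (predC (fun i => (i == 0 %[mod b]) && avoids T i || ~~ avoids T i)).
  apply: eq_freq => i /=; rewrite mod0n -/(dvdn b i).
  by case: (b %| i)%N => //=; case: (avoids T i).
have -> : freq R L (fun i => (i == 0 %[mod b]) && avoids T i || ~~ avoids T i) =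
  freq R L (fun i => (i == 0 %[mod b]) && avoids T i) + (1 - fd T).
  rewrite -(free_densityE R L0 TL) -freqN // /freq -mulrDl -natrD; congr (_%:R / _).
  rewrite /count_below -big_split; apply: eq_bigr => i _ /=.
  by case: (avoids T i); rewrite ?andbF ?andbT ?orbF ?addn0.
move: fT kb; move: (freq _ _ _) (freq _ _ _) (fd T) (inf_density _) (inf_density _).
move=> x y z k k'; lra.
Qed.

(** If the progression consisted of multiples of elements of B, its T-free part would have harmonic
    sum at least c ln n up to a constant, while the Davenport-Erdos estimate allows only (c / 2) ln
    n for a suitable T. *)
Lemma exists_avoiding B n l (c : R) : (forall b, B b -> (0 < b)%N) ->
  (0 < l)%N -> 0 < c ->
  (forall T L, seq_within T B -> (0 < L)%N -> (l %| L)%N ->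
    {in T, forall t, (t %| L)%N} ->
    c <= freq R L (fun i => (i == n %[mod l]) && avoids T i)) ->
  exists2 i, i = n %[mod l] & forall b, B b -> ~~ (b %| i)%N.
Proof.
move=> Bpos l0 c0 cT; apply: contrapT => H.
have cover i : i == n %[mod l] -> in_multiples B i.
  move=> /eqP iln; apply: contrapT => iB; apply: H; exists i => // b Bb.
  by apply/negP => bi; apply: iB; apply/in_multiplesP; exists b => //; apply: mem_set.
have E0 : 0 < expR 1 :> R by exact: expR_gt0.
(* The denominator 2 exp 1 offsets the factor exp 1 of the Davenport-Erdos estimate. *)
have [T TB fT] := inf_density_adherent B (divr_gt0 c0 (mulr_gt0 (ltr0n R 2) E0)).
have pT := within_positive Bpos TB.
pose K := (\prod_(t <- T) t)%N; pose L := (l * K)%N.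
have K0 : (0 < K)%N by exact: positive_prod.
have L0 : (0 < L)%N by rewrite muln_gt0 l0.
have TL : {in T, forall t, (t %| L)%N} by move=> t /dvdn_prod_seq; apply: dvdn_mull.
have := cT T L TB L0 (dvdn_mulr _ (dvdnn l)) TL.
pose P i := (i == n %[mod l]) && avoids T i.
have per i : P (i + L)%N = P i.
  rewrite /P avoids_periodic //; congr (_ && _).
  by rewrite /L addnC mulnC modnMDl.
rewrite -/P => cP.
pose D : R := L.+2%:R + expR 1 * (K%:R + 3%:R).
have lnD n' : (1 < n')%N -> c / 2 * ln n'%:R <= D.
  move=> n1; have n0 : (0 < n')%N by exact: ltnW.
  have lnn : 0 <= ln n'%:R :> R by rewrite ln_ge0 // ler1n.
  have h1 := harmonic_sum_periodic_ge R L0 n0 per.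
  have h2 := harmonic_sum_multiples_le Bpos TB n1.
  have h3 : harmonic_sum R P n' <=
      harmonic_sum R (fun k => in_multiples B k && avoids T k) n'.
    by apply: le_harmonic_sum => k /andP[/cover -> ->].
  have h4 : c * ln n'%:R <= freq R L P * ln n'%:R by rewrite ler_wpM2r.
  have h5 : expR 1 * ((fd T - inf_density B) * ln n'%:R) <= c / 2 * ln n'%:R.
    rewrite mulrA ler_wpM2r // -ler_pdivlMl //.
    have -> : (expR 1)^-1 * (c / 2) = c / (2 * expR 1) by field; rewrite gt_eqF.
    by rewrite lerBlDl ltW.
  move: h1 h2 h3 h4 h5; rewrite /D -/K -addrA [expR 1 * (_ + (_ + _))]mulrDr.
  move: (harmonic_sum _ _ _) (harmonic_sum _ _ _) (freq _ _ _ * _).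
  move: (ln _) (L.+2%:R) => x l2 a b f; lra.
(* Beyond exp (2 D / c + 1) the bound [lnD] fails; the shift by 2 guarantees m > 1. *)
pose m := (Num.truncn (expR (D / (c / 2) + 1) : R)).+2.
have := lnD m isT; apply/negP; rewrite -ltNge -ltr_pdivrMl ?divr_gt0 // mulrC.
apply: (@lt_le_trans _ _ (D / (c / 2) + 1)); first by rewrite ltrDl.
rewrite -[leLHS]expRK ler_ln ?posrE ?expR_gt0 ?ltr0n //.
by apply: le_trans (ltW (truncnS_gt _)) _; rewrite ler_nat.
Qed.

End Taut.

(** * The group H and its Haar measure *)

Definition lcm_seq (S : seq nat) : nat := (\big[lcmn/1]_(b <- S) b)%N.

Section LcmSeq.
Local Open Scope nat_scope.

Lemma dvdn_lcm_seqP S m : reflect {in S, forall b, b %| m} (lcm_seq S %| m).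
Proof.
elim: S => [|a S IH]; rewrite /lcm_seq ?big_nil ?big_cons.
  by rewrite dvd1n; apply: ReflectT.
rewrite dvdn_lcm; apply: (iffP andP) => [[am /IH Sm] b|H].
  by rewrite inE => /orP[/eqP->//|/Sm].
split; first by apply: H; apply: mem_head.
by apply/IH => b bS; apply: H; rewrite inE bS orbT.
Qed.

Lemma dvdn_lcm_seq S : {in S, forall b, b %| lcm_seq S}.
Proof. exact/dvdn_lcm_seqP. Qed.

Lemma lcm_seq_gt0 S : all_positive S -> 0 < lcm_seq S.
Proof.
elim: S => [|a S IH] /=; rewrite /lcm_seq ?big_nil ?big_cons //.
by move=> /andP[a0 /IH]; rewrite lcmn_gt0 a0.
Qed.

Lemma eqmod_lcm_seq S i j :
  reflect {in S, forall b, i = j %[mod b]} (i == j %[mod lcm_seq S]).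
Proof.
wlog ij : i j / i <= j.
  move=> H; have [/H//|/ltnW/H {}H] := leqP i j.
  by rewrite eq_sym; apply: (iffP H) => h b /h.
rewrite eq_sym eqn_mod_dvd //; apply: (iffP (dvdn_lcm_seqP _ _)) => H b bS.
  by apply/esym/eqP; rewrite eqn_mod_dvd // H.
by rewrite -eqn_mod_dvd // eq_sym; apply/eqP/H.
Qed.

End LcmSeq.

Section Residue.

Lemma residue_eq (b i j : nat) : (0 < b)%N ->
  residue b i = residue b j <-> i = j %[mod b].
Proof.
move=> b0; split=> [e|e]; last by rewrite /residue !modz_nat !absz_nat e.
have := val_residue i%:Z b0; rewrite e val_residue // !modz_nat.
by case.
Qed.

Lemma residue_eq0 (b : nat) (m : int) : (0 < b)%N ->
  residue b m = 0 <-> (b%:Z %| m)%Z.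
Proof.
move=> b0; have E0 : residue b 0 = 0 by rewrite -(subrr 0) residueB subrr.
split=> [e|/dvdz_mod0P e]; last by rewrite -E0 /residue e mod0z.
apply/dvdz_mod0P; have := val_residue m b0.
by rewrite e -E0 val_residue // mod0z.
Qed.

Lemma residueD_multiple (b : nat) (m n : int) : (0 < b)%N -> (b%:Z %| n)%Z ->
  residue b (m + n) = residue b m.
Proof.
move=> b0 bn; rewrite -[n]opprK residueB.
by rewrite ((residue_eq0 (- n) b0).2 _) ?subr0 // dvdzE abszN -dvdzE.
Qed.

End Residue.

(** * Cylinders of H *)

Section Cylinders.
Variable B : set nat.
Hypothesis Bpos : forall b, B b -> (0 < b)%N.
Implicit Types (h : Hgroup B) (S : seq nat).

Let val_in (b : B) : B (val b). Proof. exact: set_mem (valP b). Qed.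

Let val_pos (b : B) : (0 < val b)%N. Proof. exact/Bpos/val_in. Qed.

(** Coordinates are listed by their moduli; entries of S outside B impose nothing. *)
Definition agree S (x y : residues B) : Prop :=
  forall b : B, val b \in S -> x b = y b.

Lemma near_agree S (x : residues B) : \forall y \near x, agree S y x.
Proof.
elim: S => [|a S IH]; first by exact: (@filterE _ _ (nbhs_filter x)).
have [Ba|nBa] := pselect (B a); last first.
  apply: (@filterS _ _ (nbhs_filter x) _ _ _ IH) => y yx b; rewrite inE => /orP[/eqP ba|/yx//].
  by case: nBa; rewrite -ba.
pose a' : B := exist _ a (mem_set Ba).
have nb : \forall y \near x, y a' = x a'.
  exact: (@proj_continuous _ (fun i : B => Zmod (val i)) a' x _
    (discrete_set1 (X := Zmod (val a')) (x a'))).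
apply: (@filterS2 _ _ (nbhs_filter x) _ _ _ _ nb IH) => y ya yS b.
rewrite inE => /orP[/eqP ba|/yS//].
by have -> : b = a' by exact: val_inj.
Qed.

(** The agreement sets generate a filter that converges to x in each coordinate, hence in the
    product topology. *)
Lemma nbhs_agree (x : residues B) (U : set (residues B)) : nbhs x U ->
  exists S, forall y, agree S y x -> U y.
Proof.
pose F := filter_from setT (fun S : seq nat => [set y | agree S y x]).
have FF : Filter F.
  apply: filter_fromT_filter; first by exists [::].
  move=> S S'; exists (S ++ S') => y yx; split=> b bS; apply: yx;
  by rewrite mem_cat bS ?orbT.
suff Fx : F --> x by move=> /Fx[S _ SU]; exists S.
apply/cvg_sup => b U' [_ [[W oW <-] Wx WU]].
exists [:: val b] => // y yx; apply: WU => /=.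
by rewrite /= (yx b) ?mem_head.
Qed.

Lemma Hgroup_near_agree S h : \forall h' \near h, agree S (val h') (val h).
Proof.
exact: (@initial_continuous (Hset B) (residues B) set_val h _ (near_agree S (val h))).
Qed.

Lemma Hgroup_nbhs_agree h (U : set (Hgroup B)) : nbhs h U ->
  exists2 S, seq_within S B & forall h', agree S (val h') (val h) -> U h'.
Proof.
move=> [_ [[V oV <-] Vh VU]].
have [S SV] := nbhs_agree (open_nbhs_nbhs (conj oV Vh)).
exists [seq b <- S | b \in B].
  by move=> b; rewrite mem_filter => /andP[/set_mem].
move=> h' hh'; apply: VU; apply: SV => b bS; apply: hh'.
by rewrite mem_filter bS (valP b).
Qed.

Definition cyl S (n : nat) : set (Hgroup B) :=
  [set h | agree S (val h) (diag_residues B n)].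

(** Density of the diagonal gives an integer m agreeing with h on S; adding |m| times a positive
    common multiple of the moduli makes it nonnegative. *)
Lemma cyl_exists S h : exists n, cyl S n h.
Proof.
have [_ [[m _ <-] hm]] := set_mem (valP h) _ (near_agree S (val h)).
pose S' := [seq b <- S | b \in B].
pose L := (\prod_(b <- S') b)%N.
have L0 : (0 < L)%N.
  by apply: positive_prod; apply/allP => b; rewrite mem_filter => /andP[/set_mem/Bpos].
have mL : 0 <= m + (L * `|m|)%N%:Z.
  rewrite PoszM abszE; have := lerNnormlW (lexx `|m|).
  have : `|m| <= L%:Z * `|m| by rewrite ler_peMl.
  lra.
exists (absz (m + (L * `|m|)%N%:Z)) => b bS.
rewrite -hm // /diag_residues gez0_abs // residueD_multiple // PoszM.
apply: dvdz_mulr; rewrite dvdzE !absz_nat dvdn_prod_seq //.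
by rewrite mem_filter bS (valP b).
Qed.

Lemma cylP S h i j : seq_within S B -> cyl S i h ->
  (cyl S j h <-> i = j %[mod lcm_seq S]).
Proof.
move=> SB ih; split=> [jh|ij b bS].
  apply/eqP/eqmod_lcm_seq => b bS.
  pose b' : B := exist _ b (mem_set (SB b bS)).
  by apply/(residue_eq _ _ (Bpos (SB b bS))); exact: etrans (esym (ih b' bS)) (jh b' bS).
rewrite ih //; apply/residue_eq => //.
by move/eqP/eqmod_lcm_seq : ij; apply.
Qed.

Lemma open_determined S (A : set (Hgroup B)) :
  (forall h h', agree S (val h') (val h) -> A h -> A h') -> open A.
Proof.
move=> SA; rewrite openE => h Ah.
by apply: filterS (Hgroup_near_agree S h) => h' hh'; apply: SA Ah.
Qed.

Lemma measurable_determined S (A : set (Hgroup B)) :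
  (forall h h', agree S (val h') (val h) -> A h -> A h') ->
  measurable (A : set (borel (Hgroup B))).
Proof. by move=> SA; apply: sub_sigma_algebra; apply: open_determined SA. Qed.

Lemma measurable_cyl S n : measurable (cyl S n : set (borel (Hgroup B))).
Proof.
by apply: (@measurable_determined S) => h h' hh' hn b bS; rewrite hh' // hn.
Qed.

Lemma window_agree_avoids S n h (b : nat) : window B h -> cyl S n h -> B b -> b \in S ->
  ~~ (b %| n)%N.
Proof.
move=> Wh nh Bb bS; pose b' : B := exist _ b (mem_set Bb).
apply/negP => bn; apply: (Wh b'); rewrite nh // /diag_residues.
by apply/residue_eq0; rewrite ?Bpos // dvdzE !absz_nat.
Qed.

Lemma window_Delta (n : nat) :
  window B (Delta B n) <-> (forall b, B b -> ~~ (b %| n)%N).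
Proof.
split=> [Wn b Bb|H b /(residue_eq0 _ (val_pos b))].
  by apply: (@window_agree_avoids [:: b] n (Delta B n)) => //; apply: mem_head.
by rewrite dvdzE !absz_nat; apply/negP/H.
Qed.

Section Haar.
Variables (R : realType) (m : probability (borel (Hgroup B)) R).
Hypothesis m_haar : is_haar m.

(** The cylinder at n is the translate by Delta n of the one at 0. *)
Lemma haar_cyl0 S n : m (cyl S n) = m (cyl S 0).
Proof.
have r0 (b : B) : residue (val b) 0 = 0 by apply/residue_eq0.
rewrite -(m_haar (Delta B n) (measurable_cyl S 0)); congr (m _).
apply/seteqP; split=> [h hn|_ [h h0 <-] b bS].
  exists (h - Delta B n); last by rewrite addrC subrK.
  move=> b bS; rewrite -[LHS]/(val h b - residue (val b) n) hn // subrr.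
  exact/esym/r0.
rewrite -[LHS]/(residue (val b) n + val h b) h0 //.
exact: etrans (congr1 (+%R _) (r0 b)) (addr0 _).
Qed.

(** The cylinders over S, indexed by residues modulo lcm S, partition H and have equal measure;
    total mass 1 makes it 1 / lcm S. *)
Lemma haar_clopen S (P : pred nat) : seq_within S B ->
  (forall i, P (i + lcm_seq S)%N = P i) ->
  m [set h | exists2 i, P i & cyl S i h] = (freq R (lcm_seq S) P)%:E.
Proof.
move=> SB; set l := lcm_seq S => Pl.
have l0 : (0 < l)%N by apply: lcm_seq_gt0; apply: within_positive SB.
have sumE (Q : pred nat) : (forall i, Q (i + l)%N = Q i) ->
    m [set h | exists2 i, Q i & cyl S i h] =
    (\sum_(i < l | Q i) m (cyl S 0))%E.
  move=> Ql.
  transitivity (m (\big[setU/set0]_(i < l | Q i) cyl S i)).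
    congr (m _); rewrite -bigcup_seq_cond; apply/seteqP; split=> h.
      move=> [i Qi ih]; exists (Ordinal (ltn_pmod i l0)).
        by rewrite /= mem_index_enum (periodic_mod Ql).
      by apply/(cylP _ SB ih) => /=; rewrite modn_mod.
    by move=> [i /andP[_ Qi] ih]; exists i.
  rewrite measure_bigsetU_ord_cond; last 2 first.
  - by move=> i _; apply: measurable_cyl.
  - move=> i j _ _ [h [ih jh]]; apply/val_inj => /=.
    by have := (cylP j SB ih).1 jh; rewrite !modn_small.
  by apply: eq_bigr => i _; apply: haar_cyl0.
have mfin : m (cyl S 0) \is a fin_num by exact: fin_num_measure (measurable_cyl S 0).
set p := fine (m (cyl S 0)).
have pE : m (cyl S 0) = p%:E by rewrite fineK.
have {}sumE (Q : pred nat) : (forall i, Q (i + l)%N = Q i) ->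
    m [set h | exists2 i, Q i & cyl S i h] = ((count_below l Q)%:R * p)%:E.
  move=> /sumE ->; rewrite pE sumEFin /count_below natr_sum mulr_suml; congr (_%:E).
  rewrite big_mkord [LHS]big_mkcond; apply: eq_bigr => i _.
  by case: (Q i); rewrite ?mul1r ?mul0r.
have lp : l%:R * p = 1.
  have := sumE xpredT (fun=> erefl); rewrite /count_below sum_nat_const_nat subn0 muln1.
  rewrite (_ : [set h | _] = setT) ?probability_setT; first by case.
  by apply/seteqP; split=> // h _; have [n hn] := cyl_exists S h; exists n.
rewrite sumE //; congr (_%:E); rewrite /freq; congr (_ * _).
have lR : l%:R != 0 :> R by rewrite pnatr_eq0 -lt0n.
by apply: (mulfI lR); rewrite lp divff.
Qed.

End Haar.
End Cylinders.

(** * The window *)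

Section Window.
Variables (R : realType) (B : set nat).
Hypothesis Bpos : forall b, B b -> (0 < b)%N.

Definition members_below (k : nat) : seq nat := [seq b <- iota 0 k | b \in B].

Lemma within_members_below k : seq_within (members_below k) B.
Proof. by move=> b; rewrite mem_filter => /andP[/set_mem]. Qed.

Lemma mem_members_below k b : B b -> (b < k)%N -> b \in members_below k.
Proof. by move=> Bb bk; rewrite mem_filter mem_iota mem_set. Qed.

Lemma taut_window_cyl (h : Hgroup B) (U : set (Hgroup B)) :
  taut R B -> window B h -> nbhs h U ->
  exists S n (c : R), [/\ seq_within S B, cyl S n `<=` U, 0 < c &
    forall T L, seq_within T B -> (0 < L)%N -> (lcm_seq S %| L)%N ->
      {in T, forall t, (t %| L)%N} ->
      c <= freq R L (fun i => (i == n %[mod lcm_seq S]) && avoids T i)].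
Proof.
move=> tB Wh /Hgroup_nbhs_agree[S SB SU].
set l := lcm_seq S.
have l0 : (0 < l)%N by apply: lcm_seq_gt0; apply: within_positive SB.
(* Prescribing also the coordinates up to l ensures that no d in B divides both n and l: such a d
   would be among them and force h_d = 0. *)
have [n hn] := cyl_exists Bpos (S ++ members_below l.+1) h.
have hnS : cyl S n h by move=> b bS; apply: hn; rewrite mem_cat bS.
have [|c c0 cT] := @progression_inf_density_pos R B n l Bpos l0.
  move=> d d0; rewrite dvdn_gcd => /andP[dn dl].
  apply: taut_quotient => // Bd.
  have : d \in S ++ members_below l.+1.
    by rewrite mem_cat mem_members_below ?orbT // ltnS dvdn_leq.
  by move=> /(window_agree_avoids Bpos Wh hn Bd)/negP; apply.
exists S, n, c; split=> // h' h'n; apply: SU => b bS.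
by rewrite h'n // hnS.
Qed.

Lemma taut_window_closure : taut R B ->
  closure (range (Delta B) `&` window B) = window B.
Proof.
move=> tB; apply/seteqP; split.
  rewrite [X in _ `<=` X]((closure_id (window B)).1 (@closed_window B)).
  exact: closureS.
move=> h Wh U /(taut_window_cyl tB Wh)[S [n [c [SB SU c0 cT]]]].
have l0 : (0 < lcm_seq S)%N by apply: lcm_seq_gt0; apply: within_positive SB.
have [i iln iB] := exists_avoiding Bpos l0 c0 cT.
exists (Delta B i); split; first by split; [exists i | apply/window_Delta].
apply: SU; have iS : cyl S i (Delta B i) by [].
by apply/(cylP Bpos _ SB iS).
Qed.

Section HaarWindow.
Variable m : probability (borel (Hgroup B)) R.
Hypothesis m_haar : is_haar m.

Lemma haar_cyl_avoids S n T : seq_within S B -> seq_within T B ->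
  m [set h | exists2 i, (i == n %[mod lcm_seq S]) && avoids T i & cyl (S ++ T) i h] =
  (freq R (lcm_seq (S ++ T))
    (fun i => (i == n %[mod lcm_seq S]) && avoids T i))%:E.
Proof.
move=> SB TB; rewrite haar_clopen //.
  by move=> b; rewrite mem_cat => /orP[/SB|/TB].
move=> i; rewrite avoids_periodic => [|t tT].
  congr (_ && _); have /dvdnP[q ->] : (lcm_seq S %| lcm_seq (S ++ T))%N.
    by apply/dvdn_lcm_seqP => b bS; apply: dvdn_lcm_seq; rewrite mem_cat bS.
  by rewrite addnC modnMDl.
by apply: dvdn_lcm_seq; rewrite mem_cat tT orbT.
Qed.

(** The window inside a cylinder is a decreasing intersection of clopen sets [F k], each involving
    finitely many coordinates. Each has measure at least the same c > 0, and continuity from above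
    passes this to the limit. *)
Lemma taut_window_positive (U : set (Hgroup B)) (h : Hgroup B) :
  taut R B -> window B h -> open U -> U h -> (0 < m (U `&` window B))%E.
Proof.
move=> tB Wh oU Uh.
have [S [n [c [SB SU c0 cT]]]] := taut_window_cyl tB Wh (open_nbhs_nbhs (conj oU Uh)).
pose F k : set (borel (Hgroup B)) :=
  [set h : Hgroup B | cyl S n h /\
     forall b : B, (val b < k)%N -> val h b <> 0].
have mF k : measurable (F k).
  apply: (@measurable_determined _ (S ++ members_below k)) => h1 h2 h12 [nh1 kh1].
  split=> [b bS|b bk]; first by rewrite h12 ?nh1 // mem_cat bS.
  rewrite h12; first exact: kh1.
  by rewrite mem_cat mem_members_below ?orbT //; apply: set_mem (valP b).
have capF : \bigcap_k F k = (cyl S n `&` window B : set (borel (Hgroup B))).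
  apply/seteqP; split=> [h' H|h' [nh' Wh'] k _]; last by split=> // b _; apply: Wh'.
  split; first by have [] := H 0%N I.
  by move=> b; have [_ /(_ b (ltnSn _))] := H (val b).+1 I.
have mcap : measurable (\bigcap_k F k) by apply: bigcapT_measurable.
have Fni : nonincreasing_seq F.
  move=> i j ij; apply/subsetPset => h' [nh' jh']; split=> // b bi.
  by apply: jh'; apply: leq_trans ij.
have F0 : (m (F 0%N) < +oo)%E.
  by apply: (le_lt_trans (probability_le1 m (mF 0%N))); rewrite ltry.
have cvgF := nonincreasing_cvg_mu F0 mF mcap Fni.
have cF k : (c%:E <= m (F k))%E.
  pose T := members_below k.
  have TB : seq_within T B by exact: within_members_below.
  have STB : seq_within (S ++ T) B by move=> b; rewrite mem_cat => /orP[/SB|/TB].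
  have : (c%:E <= (freq R (lcm_seq (S ++ T))
      (fun i => (i == n %[mod lcm_seq S])%N && avoids T i))%:E)%E.
    rewrite lee_fin; apply: cT => //.
    - by apply: lcm_seq_gt0; apply: within_positive STB.
    - by apply/dvdn_lcm_seqP => b bS; apply: dvdn_lcm_seq; rewrite mem_cat bS.
    - by move=> b bT; apply: dvdn_lcm_seq; rewrite mem_cat bT orbT.
  rewrite -haar_cyl_avoids // => /le_trans; apply.
  apply: le_measure; rewrite ?inE //.
    apply: (@measurable_determined _ (S ++ T)) => h1 h2 h12 [i Pi ih1].
    by exists i => // b bS; rewrite h12 ?ih1.
  move=> h' [i /andP[iln iT] ih'].
  have ih'S : cyl S i h' by move=> b bS; apply: ih'; rewrite mem_cat bS.
  split; first by apply/(cylP Bpos _ SB ih'S)/eqP.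
  move=> b bk; have Bb : B (val b) by exact: set_mem (valP b).
  have bT : val b \in T by exact: mem_members_below.
  rewrite ih' ?mem_cat ?bT ?orbT // => /residue_eq0 -/(_ (Bpos Bb)).
  by rewrite dvdzE !absz_nat; apply/negP/(allP iT).
have : (c%:E <= m (\bigcap_k F k))%E.
  rewrite -(cvg_lim _ cvgF) //; apply: lime_ge; first by apply/cvg_ex; eexists; exact: cvgF.
  exact: nearW.
rewrite capF => cm; apply: lt_le_trans (le_trans cm _); first by rewrite lte_fin.
have mU : measurable (U : set (borel (Hgroup B))) by exact: sub_sigma_algebra.
apply: le_measure; rewrite ?inE -?capF //.
  exact: measurableI mU (measurable_window B).
by rewrite capF => h' [/SU Uh' Wh'].
Qed.

Lemma taut_haar_regular : taut R B -> haar_regular m.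
Proof.
move=> tB; apply/seteqP; split=> h /=.
  (* The complement of the closed set W is open and null for the restricted measure. *)
  move=> H; apply: contrapT => nWh.
  have := H (~` window B) (closed_openC (@closed_window B)) nWh.
  by rewrite /mrestr setICl measure0 ltxx.
by move=> Wh U oU Uh; apply: taut_window_positive Uh.
Qed.

Lemma haar_regular_taut : primitive B -> haar_regular m -> taut R B.
Proof.
move=> Bprim reg; apply: contrapT => /(not_taut_quotient Bpos Bprim).
move=> [b [d [Bb db dneb small]]].
have d0 : (0 < d)%N by exact: dvdn_gt0 (Bpos Bb) db.
(* An element of B dividing d divides b, so it equals b by primitivity, which is impossible for a
   proper divisor d. *)
have Wd : window B (Delta B d).
  apply/(window_Delta Bpos) => b' Bb'; apply/negP => b'd.
  have b'b := Bprim _ _ Bb' Bb (dvdn_trans b'd db).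
  by apply: dneb; apply/eqP; rewrite eqn_dvd db -b'b.
pose S := [:: b]; pose U := @cyl B S d.
have SB : seq_within S B by move=> a; rewrite inE => /eqP ->.
have lS : lcm_seq S = b by rewrite /lcm_seq big_seq1.
have oU : open U.
  by apply: (@open_determined _ S) => h h' hh' hn a aS; rewrite hh' // hn.
have : supp (T := Hgroup B) (mrestr m (measurable_window B)) (Delta B d).
  by rewrite reg.
move=> /(_ U oU (fun _ _ => erefl)); rewrite /mrestr; apply/negP; rewrite -leNgt.
apply/lee_addgt0Pr => e e0; rewrite add0e.
have [T TB fT] := inf_densityPn small e0.
pose T' := [seq (d * t)%N | t <- T].
have T'B : seq_within T' B by move=> _ /mapP[t tT ->]; apply: TB.
have pT : all_positive T.
  by apply/allP => t /TB/Bpos; rewrite muln_gt0 => /andP[].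
have VB : seq_within (S ++ T') B by move=> a; rewrite mem_cat => /orP[/SB|/T'B].
(* An integer i representing a point of the window in [U] is d modulo b, hence a multiple of d, and
   avoids d T; such integers have density fd T / d < e. *)
apply: (@le_trans _ _ (m [set h | exists2 i,
    (i == d %[mod lcm_seq S]) && avoids T' i & cyl (S ++ T') i h])).
  apply: le_measure; rewrite ?inE.
  - apply: measurableI (measurable_window B); exact: measurable_cyl.
  - apply: (@measurable_determined _ (S ++ T')) => h1 h2 h12 [i Pi ih1].
    by exists i => // a aS; rewrite h12 ?ih1.
  move=> h [Uh Wh]; have [i hi] := cyl_exists Bpos (S ++ T') h.
  exists i => //; apply/andP; split.
    apply/eqP/esym; apply/(cylP Bpos _ SB Uh) => a aS.
    by apply: hi; rewrite mem_cat aS.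
  apply/allP => t tT'; apply: (window_agree_avoids Bpos Wh hi (T'B _ tT')).
  by rewrite mem_cat tT' orbT.
rewrite haar_cyl_avoids // lee_fin; apply: le_trans (ltW fT).
set L := lcm_seq (S ++ T').
have L0 : (0 < L)%N by apply: lcm_seq_gt0; apply: within_positive VB.
apply: (@le_trans _ _ (free_density R T / d%:R)); last first.
  by rewrite ler_pdivrMr ?ltr0n // ler_peMr ?free_density_ge0 // ler1n.
rewrite -(free_density_map_mul R d0 L0 pT); last 2 first.
- move=> t tT; apply: dvdn_lcm_seq; rewrite mem_cat; apply/orP; right.
  by apply: map_f.
- by apply: (dvdn_trans db); apply: dvdn_lcm_seq; rewrite mem_head.
apply: le_freq => i; rewrite lS => /andP[/eqP ib ->]; rewrite andbT.
by rewrite /dvdn -(modn_dvdm _ db) ib modn_dvdm // modnn.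
Qed.

End HaarWindow.
End Window.

Theorem theoremA (R : realType) (B : set nat)
    (Bpos : forall b, B b -> (0 < b)%N)
    (Binf : infinite_set B)
    (Bprim : primitive B)
    (mH : probability (borel (Hgroup B)) R)
    (mH_haar : is_haar mH) :
  (taut R B <-> haar_regular mH) /\
  ((taut R B \/ haar_regular mH) ->
    closure (range (Delta B) `&` window B) = window B).
Proof.
have iff : taut R B <-> haar_regular mH.
  by split; [apply: taut_haar_regular | apply: haar_regular_taut].
by split=> // -[|/iff] tB; apply: taut_window_closure tB.
Qed.
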